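(* If $X$ is a Suslinian chainable continuum and $E(X)$ denotes the set of all endpoints of $X$, then $E(X)$ (with the subspace topology) is zero-dimensional at some point; that is, there exists a point $e\in E(X)$ such that $E(X)$ is zero-dimensional at $e$.
   Context: A continuum is a compact connected metric space. A continuum $X$ is Suslinian if there is no uncountable collection of pairwise disjoint non-degenerate subcontinua of $X$ (non-degenerate means having more than one point). For $\varepsilon>0$, an $\varepsilon$-chain covering $X$ is a finite sequence of open sets $U_1,\ldots,U_n$ covering $X$ such that $\operatorname{diam}(U_i)<\varepsilon$ for all $i\le n$, and $U_i\cap U_j\neq\varnothing$ if and only if $|i-j|\leq 1$, for all $i,j\leq n$. A continuum $X$ is chainable if for every $\varepsilon>0$ there is an $\varepsilon$-chain covering $X$. A point $x$ of a chainable continuum $X$ is an endpoint of $X$ if for every $\varepsilon>0$ the $\varepsilon$-chain $U_1,\ldots,U_n$ covering $X$ can be chosen so that $x\in U_1$. The set of all endpoints of $X$ is denoted $E(X)$. A topological space $Y$ is zero-dimensional at $y\in Y$ if every neighborhood of $y$ in $Y$ contains a clopen (in $Y$) neighborhood of $y$. *)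

(* Defs.v *)
From HB Require Import structures.
From mathcomp Require Import all_boot all_order all_algebra.
From mathcomp Require Import all_classical all_reals.
From mathcomp Require Import ereal topology.

Set Implicit Arguments.
Unset Strict Implicit.
Unset Printing Implicit Defensive.

Import Order.TTheory GRing.Theory Num.Theory.

Local Open Scope classical_set_scope.
Local Open Scope ring_scope.

Section Continua.
Context {R : realType} {X : metricType R}.

(* Applied both to the whole space [set: X] and to subsets of X (subcontinua);
   as usual in continuum theory, continua are nonempty. *)
Definition continuum (A : set X) : Prop :=
  [/\ A !=set0, compact A & connected A].

Definition nondegenerate (A : set X) : Prop :=
  exists x y, [/\ A x, A y & x <> y].

(* The diameter of the empty set is -oo; the links of a chain are nonempty. *)
Definition diam (A : set X) : \bar R :=
  ereal_sup [set (mdist x y)%:E | x in A & y in A].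

(* The links U_1, ..., U_(n+1) are U 0, ..., U n.  The case i = j of the last
   condition makes every link nonempty. *)
Definition is_chain (eps : R) (n : nat) (U : 'I_n.+1 -> set X) : Prop :=
  [/\ forall i, open (U i),
      \bigcup_i U i = [set: X],
      forall i, (diam (U i) < eps%:E)%E &
      forall i j, (U i `&` U j !=set0) <-> `|i%:Z - j%:Z| <= 1].

End Continua.

Definition Suslinian (R : realType) (X : metricType R) : Prop :=
  ~ exists C : set (set X),
      [/\ ~ countable C,
          forall A, C A -> continuum A /\ nondegenerate A &
          trivIset C id].

Definition chainable (R : realType) (X : metricType R) : Prop :=
  forall eps : R, 0 < eps -> exists n (U : 'I_n.+1 -> set X), is_chain eps U.

Definition endpoints (R : realType) (X : metricType R) : set X :=
  [set x | forall eps : R, 0 < eps ->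
     exists n (U : 'I_n.+1 -> set X), is_chain eps U /\ U ord0 x].
Arguments endpoints {R} X _.

Definition zero_dimensional_at (Y : topologicalType) (y : Y) : Prop :=
  forall N : set Y, nbhs y N ->
    exists V : set Y, [/\ clopen V, V y & V `<=` N].

(* Main.v *)
From HB Require Import structures.
Require Import Defs.
From mathcomp Require Import all_boot all_order all_algebra.
From mathcomp Require Import all_classical all_reals.
From mathcomp Require Import ereal topology.
From mathcomp Require Import zify.

Set Implicit Arguments.
Unset Strict Implicit.
Unset Printing Implicit Defensive.

Import Order.TTheory GRing.Theory Num.Theory.

Local Open Scope classical_set_scope.
Local Open Scope ring_scope.

(** Let [E] be the set of endpoints of [X]. Two facts reduce the statement to the
    theory of continua. An endpoint [e] is nested: of two subcontinua containing
    [e], one contains the other ([endpoint_nested]), because a subcontinuum that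
    contains [e] and reaches a given link of a chain beginning at [e] meets all
    the earlier links, so it passes near every point in them. And every
    nondegenerate subcontinuum of the Suslinian continuum [X] is decomposable
    ([suslinian_decomposable]): an indecomposable one would have, by Baire,
    uncountably many composants, which are pairwise disjoint and contain
    nondegenerate continua.

    For [e] in [E] let [hull E e] be the intersection of the closures in [X] of
    all relatively clopen subsets of [E] that contain [e]. By compactness this is
    a continuum, and [E] is zero-dimensional at [e] as soon as [hull E e] is the
    single point [e]. So suppose that no hull is degenerate. Three facts lead to
    a contradiction.

    - Ends. Let [K] be a nondegenerate hereditarily decomposable continuum and
      [e] a nested point of [K]. The proper subcontinua of [K] that are
      neighbourhoods of [e] in [K] are nested and shrink to a nowhere dense
      continuum, the near end; the closures of their complements shrink to the far end. All nested
      points of [K] lie in one of the two ends, the ends are disjoint, and [K] is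
      irreducible between them ([nested_in_ends], [near_far_disjoint],
      [ends_irreducible]).
    - Every hull [K = hull E e] is a limit of other hulls. If no other hull met
      neighbourhoods of both ends of [K], the points of [E] close to [K] but
      outside it could be distributed among the two ends in a relatively clopen
      manner, and [e] would have a clopen neighbourhood whose closure misses the
      far end, although the far end lies in [K]. Hence other hulls near [K] reach
      from one end to the other and, by irreducibility, are nearly as wide as [K]
      ([wide_hull_nearby]).
    - A hull meets at most one hull other than itself ([hull_disjoint_or]), by
      nestedness applied to unions of hulls.

    So every relatively clopen set containing a point with a hull wider than [d]
    contains two such sets with disjoint closures. The resulting Cantor scheme has
    uncountably many disjoint branches, and the limit along each of them contains
    a nondegenerate continuum ([cantor_scheme_not_suslinian]).

    This needs a point of [E] to begin with. By Zorn's lemma there is a minimal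
    continuum in which chains of arbitrarily small mesh can begin. If it were
    nondegenerate it would be the union of two proper subcontinua, and chains of
    arbitrarily small mesh could begin in one of them; so it is a single point,
    and that is an endpoint. The work is in showing that this property passes to
    nested intersections ([initial_starts_chains]). *)

(* [nondegenerate] also names a property of bilinear forms. *)
Local Notation nondegenerate := Defs.nondegenerate.

(** * Connectedness and compactness *)

Section Connectedness.
Context {T : topologicalType}.
Implicit Types A P Q O : set T.

Lemma connected_open_split A O1 O2 : connected A -> open O1 -> open O2 ->
  A `<=` O1 `|` O2 -> (forall x, A x -> O1 x -> O2 x -> False) ->
  (exists2 x, A x & O1 x) -> A `<=` O1.
Proof.
move=> cA o1 o2 A12 dis [x Ax O1x].
suff <- : A `&` O1 = A by move=> y [].
apply: cA; first by exists x.
- by exists O1.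
- exists (~` O2); first exact: open_closedC.
  apply/seteqP; split=> y [Ay].
  + by move=> O1y; split=> // O2y; exact: (dis y).
  + by move=> nO2y; split=> //; case: (A12 _ Ay).
Qed.

Lemma connected_closed_split A P Q : connected A -> closed P -> closed Q ->
  A `<=` P `|` Q -> (forall x, A x -> P x -> Q x -> False) ->
  (exists2 x, A x & P x) -> A `<=` P.
Proof.
move=> cA cP cQ APQ dis [x Ax Px].
have : A `<=` ~` Q.
  apply: (@connected_open_split A (~` Q) (~` P)) => //; try exact: closed_openC.
  + move=> y Ay; have [Qy|nQ] := pselect (Q y); last by left.
    by right=> Py; exact: (dis y).
  + by move=> y Ay nQ nP; case: (APQ y Ay).
  + by exists x => // Qx; exact: (dis x).
by move=> AQ y Ay; case: (APQ y Ay) => // /(AQ y Ay).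
Qed.

Lemma closed_connected A x : closed A ->
  (forall P Q, closed P -> closed Q -> A = P `|` Q ->
     (forall y, P y -> Q y -> False) -> P x -> Q = set0) ->
  A x -> connected A.
Proof.
move=> cA H Ax; apply: contrapT => /connectedPn [E [E0 AE sE]].
have dis y : E false y -> E true y -> False.
  by move=> Ef Et; have /seteqP[s0 _] := separated_disjoint sE; case: (s0 y).
have clE b : closed (E b).
  move=> y clEy.
  have Ay : A y.
    apply: cA; apply: closureS clEy; rewrite AE.
    by case: b => z Ez; [right|left].
  move: Ay; rewrite AE; move: sE => [] /seteqP[s1 _] /seteqP[s2 _].
  case: b clEy => clEy [] // Ey.
  - by case: (s2 y).
  - by case: (s1 y).
move: (Ax); rewrite AE => -[Ex|Ex].
- have [y Ey] := E0 true.
  have : E true = set0 by apply: (H (E false) (E true)).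
  by move=> /seteqP[/(_ y Ey)].
- have [y Ey] := E0 false.
  have : E false = set0.
    by apply: (H (E true) (E false)) => // [|z Et Ef]; [rewrite setUC|exact: (dis z)].
  by move=> /seteqP[/(_ y Ey)].
Qed.

End Connectedness.

Section CompactHausdorff.
Context {T : topologicalType}.
Hypotheses (hT : hausdorff_space T) (cT : compact [set: T]).
Implicit Types (A P Q O K C : set T) (FF : set (set T)).

Lemma closed_compactT A : closed A -> compact A.
Proof. by move=> cA; exact: subclosed_compact cA cT _. Qed.

Lemma closed_point (x : T) : closed [set x].
Proof. exact: (accessible_closed_set1 (hausdorff_accessible hT)). Qed.

Lemma closed_open_shrink P O : closed P -> open O -> P `<=` O ->
  exists U, [/\ open U, P `<=` U & closure U `<=` O].
Proof.
move=> cP oO PO.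
have := @compact_normal _ hT cT _ cP O.
case; first by apply/set_nbhsP; exists O; split.
move=> B /set_nbhsP[U [oU PU UB]] BO; exists U; split => //.
exact: subset_trans (closureS UB) BO.
Qed.

Lemma closed_disjoint_open P Q : closed P -> closed Q ->
  (forall x, P x -> Q x -> False) ->
  exists U V, [/\ open U, open V, P `<=` U, Q `<=` V &
    forall x, U x -> V x -> False].
Proof.
move=> cP cQ dis.
have [|U [oU PU UQ]] := @closed_open_shrink P (~` Q) cP (closed_openC cQ).
  by move=> x Px Qx; exact: (dis x).
exists U, (~` closure U); split=> //.
- exact/closed_openC/closed_closure.
- by move=> x Qx /UQ.
- by move=> x /subset_closure.
Qed.

Definition filtered FF := FF !=set0 /\
  forall F G, FF F -> FF G -> exists2 H, FF H & H `<=` F `&` G.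

Lemma filtered_bigcap_open FF O : filtered FF -> (forall F, FF F -> closed F) ->
  open O -> \bigcap_(F in FF) F `<=` O -> exists2 F, FF F & F `<=` O.
Proof.
move=> [[F0 FF0] Fdir] Fcl oO FO; apply: contrapT => nF.
pose G := filter_from FF (fun F => F `&` ~` O).
have PG : ProperFilter G.
  apply: filter_from_proper.
    apply: filter_from_filter; first by exists F0.
    move=> F1 F2 F1F F2F; have [H HF HS] := Fdir _ _ F1F F2F.
    by exists H => // x [/HS [F1x F2x] nO]; split; split.
  move=> F FFF; apply: contrapT => nE; apply: nF; exists F => // x Fx.
  by apply: contrapT => nO; apply: nE; exists x.
have [p [_ clp]] := cT PG filterT.
have Fp F : FF F -> F p.
  move=> FFF; apply: (Fcl _ FFF) => B nB.
  have GF : G F by exists F => // ? [].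
  by have [y [Fy By]] := clp _ _ GF nB; exists y.
have Op : O p by apply: FO.
have GO : G (~` O) by exists F0 => // ? [].
by have [y []] := clp _ _ GO (open_nbhs_nbhs (conj oO Op)).
Qed.

Lemma filtered_bigcap_neq0 FF : filtered FF -> (forall F, FF F -> closed F) ->
  (forall F, FF F -> F !=set0) -> \bigcap_(F in FF) F !=set0.
Proof.
move=> FFf Fcl F0; apply: contrapT => I0.
have [|F FFF FE] := filtered_bigcap_open FFf Fcl open0.
  by move=> x Ix; apply: I0; exists x.
by have [x /FE] := F0 _ FFF.
Qed.

(** The common reason why nested intersections of continua, quasi-components of
    compacta and the hulls defined below are connected: a splitting of [F] by
    open sets is refined by a member of the family on the side of [x], so the
    intersection cannot have points on the other side. *)
Lemma filtered_bigcap_connected FF x : filtered FF ->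
  (forall F, FF F -> closed F) -> (forall F, FF F -> F x) ->
  (forall F O1 O2, FF F -> open O1 -> open O2 ->
     (forall y, O1 y -> O2 y -> False) -> F `<=` O1 `|` O2 -> O1 x ->
     exists2 G, FF G & G `<=` O1) ->
  connected (\bigcap_(F in FF) F).
Proof.
move=> FFf Fcl Fx Fsplit.
apply: (@closed_connected _ _ x); [exact: closed_bigI| |by move=> F /Fx].
move=> P Q cP cQ FPQ dis Px.
have [U [V [oU oV PU QV UV]]] := closed_disjoint_open cP cQ dis.
have [F FFF FUV] : exists2 F, FF F & F `<=` U `|` V.
  apply: filtered_bigcap_open => //; first exact: openU.
  by rewrite FPQ => y [/PU|/QV]; [left|right].
have [G FFG GU] := Fsplit F U V FFF oU oV UV FUV (PU _ Px).
apply/seteqP; split => // y Qy.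
apply: (UV y (GU _ _) (QV _ Qy)).
have : (P `|` Q) y by right.
by rewrite -FPQ; apply.
Qed.

Lemma total_on_filtered FF : FF !=set0 -> total_on FF subset -> filtered FF.
Proof.
move=> FF0 tFF; split=> // F G FFF FFG.
by case: (tFF F G FFF FFG) => FG; [exists F|exists G] => // x ?; split=> //; exact: FG.
Qed.

Lemma decreasing_filtered (F : nat -> set T) :
  (forall m n, (m <= n)%N -> F n `<=` F m) -> filtered (range F).
Proof.
move=> Fmono; split; first by exists (F 0%N), 0%N.
move=> _ _ [m _ <-] [n _ <-]; exists (F (maxn m n)); first by exists (maxn m n).
by move=> x Fx; split; apply: Fmono Fx; [exact: leq_maxl|exact: leq_maxr].
Qed.

Lemma nested_bigcap_connected FF x : total_on FF subset -> FF !=set0 ->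
  (forall F, FF F -> [/\ closed F, connected F & F x]) ->
  connected (\bigcap_(F in FF) F).
Proof.
move=> tFF FF0 FFP; apply: (@filtered_bigcap_connected _ x).
- exact: total_on_filtered.
- by move=> F /FFP [].
- by move=> F /FFP [].
- move=> F O1 O2 FFF o1 o2 dis F12 O1x; exists F => //.
  have [cF coF Fx] := FFP _ FFF.
  apply: (connected_open_split coF o1 o2 F12); first by move=> y _; exact: dis.
  by exists x.
Qed.

(** Components and quasi-components of a compactum [Z] agree: the relatively clopen
    sets containing [x] intersect in a connected set, hence in the component. *)
Lemma component_clopen_trace Z x O : closed Z -> Z x -> open O ->
  connected_component Z x `<=` O ->
  exists P Q, [/\ closed P /\ closed Q, Z = P `|` Q,
    forall y, P y -> Q y -> False, P x & P `<=` O].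
Proof.
move=> cZ Zx oO ZO.
pose FF := [set P | exists Q, [/\ closed P, closed Q, Z = P `|` Q,
    forall y, P y -> Q y -> False & P x]].
have FFI P Q P' Q' : Z = P `|` Q -> Z = P' `|` Q' ->
    Z = (P `&` P') `|` (Q `|` Q').
  move=> ZE ZE'; apply/seteqP; split=> y.
  + move=> Zy; have : (P `|` Q) y by rewrite -ZE.
    have : (P' `|` Q') y by rewrite -ZE'.
    move=> [P'y|Q'y] [Py|Qy]; first by left.
    - by right; left.
    - by right; right.
    - by right; left.
  + by case=> [[Py _]|[Qy|Q'y]]; [rewrite ZE; left|rewrite ZE; right|rewrite ZE'; right].
have FFf : filtered FF.
  split.
    exists Z, set0; split => //; first exact: closed0.
    by rewrite setU0.
  move=> P P' [Q [cP cQ ZE dis Px]] [Q' [cP' cQ' ZE' dis' P'x]].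
  exists (P `&` P') => //; exists (Q `|` Q'); split=> //.
  - exact: closedI.
  - exact: closedU.
  - exact: FFI.
  - by move=> y [Py P'y] [Qy|Q'y]; [exact: (dis y)|exact: (dis' y)].
have FFcl F : FF F -> closed F by case=> Q [].
have coFF : connected (\bigcap_(F in FF) F).
  apply: (@filtered_bigcap_connected _ x) => //; first by move=> F [Q []].
  move=> F O1 O2 [Q [cF cQ ZE dis Fx]] o1 o2 dis12 F12 O1x.
  exists (F `&` ~` O2); last by move=> y [/F12[]].
  exists (Q `|` (F `&` ~` O1)); split => //.
  - by apply: closedI => //; exact: open_closedC.
  - by apply: closedU => //; apply: closedI => //; exact: open_closedC.
  - rewrite ZE; apply/seteqP; split=> y.
    + case=> [Fy|Qy]; last by right; left.
      have [O2y|nO2] := pselect (O2 y); last by left.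
      by right; right; split=> // O1y; exact: (dis12 y).
    + by case=> [[]|[|[]]]; [left|right|left].
  - move=> y [Fy nO2] [Qy|[_ nO1]]; first exact: (dis y).
    by case: (F12 _ Fy).
  - by split=> // O2x; exact: (dis12 x).
have FFO : \bigcap_(F in FF) F `<=` O.
  apply: subset_trans ZO; apply: connected_component_max => //.
  - by move=> F [Q []].
  - move=> y; apply.
    exists set0; split => //; first exact: closed0.
    by rewrite setU0.
have [P [Q [cP cQ ZE dis Px]] PO] := filtered_bigcap_open FFf FFcl oO FFO.
by exists P, Q; split.
Qed.

(** The cut-wire theorem: quasi-components separate [M] from each point of [L], and
    compactness of [L] makes the separation uniform. *)
Lemma cut_wire Z L M : closed Z -> closed L -> closed M -> L `<=` Z ->
  (forall C, connected C -> C `<=` Z -> C `&` L !=set0 -> C `&` M !=set0 -> False) ->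
  exists P Q, [/\ closed P /\ closed Q, Z = P `|` Q,
    forall y, P y -> Q y -> False, L `<=` P & forall y, M y -> P y -> False].
Proof.
move=> cZ cL cM LZ H.
pose FF := [set Q | exists P, [/\ closed P, closed Q, Z = P `|` Q,
    forall y, P y -> Q y -> False & forall y, M y -> P y -> False]].
have FFf : filtered FF.
  split.
    exists Z, set0; split => //; first exact: closed0.
    by rewrite set0U.
  move=> Q Q' [P [cP cQ ZE dis MP]] [P' [cP' cQ' ZE' dis' MP']].
  exists (Q `&` Q') => //; exists (P `|` P'); split=> //.
  - exact: closedU.
  - exact: closedI.
  - apply/seteqP; split=> y.
    + move=> Zy; have : (P `|` Q) y by rewrite -ZE.
      have : (P' `|` Q') y by rewrite -ZE'.
      move=> [P'y|Q'y] [Py|Qy]; last by right.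
      * by left; left.
      * by left; right.
      * by left; left.
    + by case=> [[Qy|Q'y]|[Py _]]; [rewrite ZE; left|rewrite ZE'; left|rewrite ZE; right].
  - by move=> y [Py|P'y] [Qy Q'y]; [exact: (dis y)|exact: (dis' y)].
  - by move=> y My [Py|P'y]; [exact: (MP y)|exact: (MP' y)].
have FFcl F : FF F -> closed F by case=> P [].
have FFL : \bigcap_(F in FF) F `<=` ~` L.
  move=> y Fy Ly.
  have [|P [Q [[cP cQ] ZE dis Py PM]]] :=
    @component_clopen_trace Z y (~` M) cZ (LZ _ Ly) (closed_openC cM).
    move=> z Cz Mz; apply: (H (connected_component Z y)).
    - exact: component_connected.
    - exact: connected_component_sub.
    - by exists y; split=> //; apply: connected_component_refl; exact: LZ.
    - by exists z.
  have Qy : Q y by apply: Fy; exists P; split => // z Mz Pz; exact: (PM z).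
  exact: (dis y).
have [Q [P [cP cQ ZE dis MP]] QL] :=
  filtered_bigcap_open FFf FFcl (closed_openC cL) FFL.
exists P, Q; split => // y Ly.
by have := LZ _ Ly; rewrite ZE => -[// | /QL].
Qed.

End CompactHausdorff.

(** * Subcontinua of a compact metric space *)

Section Continua.
Context {R : realType} {X : metricType R}.
Hypothesis cX : compact [set: X].
Implicit Types (A B C K N P Q : set X) (FF : set (set X)).

Let hX : hausdorff_space X := @metric_hausdorff R X.

Definition decomposable K := exists A B,
  [/\ continuum A, continuum B, K = A `|` B, A <> K & B <> K].

(** Two subcontinua cannot branch apart at such a point; endpoints are of this
    kind. *)
Definition nested_at (x : X) := forall A B,
  continuum A -> continuum B -> A x -> B x -> A `<=` B \/ B `<=` A.

(** In a decomposition of [K] with first piece [C], this is the smallest possible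
    second piece; for closed [C], [rest K C = K] says that [C] is nowhere dense in
    [K]. *)
Definition rest K C := closure (K `\` C).

Lemma continuum_closed A : continuum A -> closed A.
Proof. by case=> _ /(compact_closed hX). Qed.

Lemma continuumP A : A !=set0 -> closed A -> connected A -> continuum A.
Proof. by move=> A0 cA coA; split=> //; exact: closed_compactT. Qed.

Lemma continuumU A B : continuum A -> continuum B -> A `&` B !=set0 ->
  continuum (A `|` B).
Proof.
move=> [[a Aa] cA coA] [_ cB coB] AB; split; [|exact: compactU|exact: connectedU].
by exists a; left.
Qed.

Lemma nondegenerateN A x : A x -> ~ nondegenerate A -> A = [set x].
Proof.
move=> Ax nA; apply/seteqP; split=> y; last by move->.
by move=> Ay; apply: contrapT => yx; apply: nA; exists y, x.
Qed.

Lemma rest_closed K C : closed (rest K C). Proof. exact: closed_closure. Qed.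

Lemma rest_sub K C : closed K -> rest K C `<=` K.
Proof.
by move=> cK x; move/closure_id: cK => {2}->; apply: closureS => y [].
Qed.

Lemma rest_cover K C x : K x -> C x \/ rest K C x.
Proof.
move=> Kx; have [Cx|nCx] := pselect (C x); first by left.
by right; apply: subset_closure.
Qed.

Lemma rest_min K C B : closed B -> K `<=` C `|` B -> rest K C `<=` B.
Proof.
move=> cB KCB; move/closure_id: cB => ->; apply: closureS => y [Ky nC].
by case: (KCB _ Ky).
Qed.

Lemma restS K C C' : C `<=` C' -> rest K C' `<=` rest K C.
Proof. by move=> CC; apply: closureS => y [Ky nC]; split=> // /CC. Qed.

Lemma rest_neq0 K C : C `<=` K -> C <> K -> rest K C !=set0.
Proof.
move=> CK nCK; apply: contrapT => r0; apply: nCK; apply/seteqP; split=> // x Kx.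
by case: (rest_cover C Kx) => // rx; case: r0; exists x.
Qed.

(** A separation of [C `|` P] with [C] on one side would have its other side inside
    [P], hence away from [Q], and would separate [K]. *)
Lemma connected_drop_piece K C P Q : connected K -> continuum C -> closed P ->
  closed Q -> K = C `|` (P `|` Q) -> (forall y, P y -> Q y -> False) ->
  continuum (C `|` P).
Proof.
move=> coK Cc cP cQ KE dis; have cC := continuum_closed Cc.
have [[c Cc0] _ coC] := Cc; apply: continuumP; first by exists c; left.
  exact: closedU.
apply: (@closed_connected _ _ c); [exact: closedU| |by left].
move=> F G cF cG CPE disFG Fc.
have CF : C `<=` F.
  apply: (connected_closed_split coC cF cG); last by exists c.
  - by rewrite -CPE; left.
  - by move=> x _; exact: disFG.
have GP : G `<=` P.
  move=> x Gx; have : (C `|` P) x by rewrite CPE; right.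
  by move=> [/CF/disFG/(_ Gx)|].
have KF : K `<=` F `|` Q.
  apply: (connected_closed_split coK (closedU cF cQ) cG).
  - rewrite KE => x [Cx|[Px|Qx]]; [by left; left; exact: CF| |by left; right].
    have : (C `|` P) x by right.
    by rewrite CPE => -[]; [left; left|right].
  - by move=> x _ [Fx|Qx] Gx; [exact: (disFG x)|exact: (dis x (GP _ Gx))].
  - by exists c; [rewrite KE; left|left].
apply/seteqP; split=> // x Gx; have Px := GP _ Gx.
have /KF : K x by rewrite KE; right; left.
by move=> [Fx|Qx]; [exact: (disFG x)|exact: (dis x)].
Qed.

(** If [rest K C] splits, [C] together with either part is a continuum. So a
    subcontinuum of an indecomposable [K], and one at a nested point of any [K],
    has a connected rest. *)
Lemma rest_connected_or K C : continuum K -> continuum C -> C `<=` K ->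
  connected (rest K C) \/
  exists A B, [/\ continuum A, continuum B, C `<=` A, C `<=` B &
    [/\ K = A `|` B, A <> K & B <> K]].
Proof.
move=> Kc Cc CK; have cK := continuum_closed Kc; have [_ _ coK] := Kc.
have [|nc] := pselect (connected (rest K C)); [by left|right].
have [[x rx]|r0] := pselect (rest K C !=set0); last first.
  exfalso; apply: nc; rewrite (_ : rest K C = set0); first exact: connected0.
  by apply/seteqP; split=> // y ry; apply: r0; exists y.
apply: contrapT => nAB; apply: nc.
apply: (@closed_connected _ _ x) => //; first exact: rest_closed.
move=> P Q cP cQ rE dis Px; apply: contrapT => Q0.
have KE : K = C `|` (P `|` Q).
  rewrite -rE; apply/seteqP; split; first by move=> y /rest_cover-/(_ C).
  by move=> y [/CK|/(rest_sub cK)].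
have proper P' Q' : closed P' -> rest K C = P' `|` Q' ->
    (forall y, P' y -> Q' y -> False) -> Q' <> set0 -> C `|` P' <> K.
  move=> cP' rE' dis' Q'0 CPK; apply: Q'0; apply/seteqP; split=> // y Q'y.
  apply: (dis' y) => //; apply: (@rest_min K C P' cP'); first by rewrite CPK.
  by rewrite rE'; right.
apply: nAB; exists (C `|` P), (C `|` Q).
have rE' : rest K C = Q `|` P by rewrite setUC.
split; [| |by left|by left|].
- exact: (connected_drop_piece coK Cc cP cQ KE dis).
- apply: (connected_drop_piece coK Cc cQ cP); first by rewrite (setUC Q).
  by move=> y Qy Py; exact: (dis y).
- split; [| |].
  + by rewrite setUACA setUid.
  + exact: (proper P Q).
  + apply: (proper Q P) => //; first by move=> y Qy Py; exact: (dis y).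
    by move=> P0; move: Px; rewrite P0.
Qed.

Lemma nested_bigcap_continuum FF : total_on FF subset -> FF !=set0 ->
  (forall F, FF F -> continuum F) -> continuum (\bigcap_(F in FF) F).
Proof.
move=> tFF FF0 FFc.
have FFcl F : FF F -> closed F by move=> /FFc/continuum_closed.
have [x Ix] : \bigcap_(F in FF) F !=set0.
  apply: (filtered_bigcap_neq0 cX (total_on_filtered FF0 tFF) FFcl).
  by move=> F /FFc[].
apply: continuumP; [by exists x|exact: closed_bigI|].
apply: (@nested_bigcap_connected _ hX cX _ x) => // F FFF.
by have [_ _ coF] := FFc _ FFF; split => //; [exact: FFcl|exact: Ix].
Qed.

Lemma connected_closedU_meet K A B : connected K -> closed A -> closed B ->
  K = A `|` B -> A !=set0 -> B !=set0 -> A `&` B !=set0.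
Proof.
move=> coK cA cB KE [a Aa] [b Bb]; apply: contrapT => AB0.
have dis x : A x -> B x -> False by move=> Ax Bx; apply: AB0; exists x.
have /(_ b) : K `<=` A.
  apply: (connected_closed_split coK cA cB); first by rewrite KE.
    by move=> x _; exact: dis.
  by exists a; [rewrite KE; left|].
by rewrite KE => /(_ (or_intror Bb)) /dis; apply.
Qed.

(** * The two ends of a continuum at a nested point *)

Section Ends.
Variables (K : set X) (e : X).
Hypotheses (Kc : continuum K) (Knd : nondegenerate K) (Ke : K e).
Hypothesis e_nested : nested_at e.
Hypothesis Kdec :
  forall C, continuum C -> nondegenerate C -> C `<=` K -> decomposable C.

Let cK : closed K. Proof. exact: continuum_closed. Qed.
Let coK : connected K. Proof. by case: Kc. Qed.

(** The condition [~ rest K C e] says that [C] is a neighbourhood of [e] in [K]. *)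
Definition collar C := [/\ continuum C, C e, C `<=` K, C <> K & ~ rest K C e].

(** When [K] is chainable and hereditarily decomposable, these are the first and
    the last fibre of the monotone map with nowhere dense fibres from [K] onto an
    interval, oriented so that [e] lies in the first one. *)
Definition near_end := \bigcap_(C in collar) C.
Definition far_end := \bigcap_(C in collar) rest K C.

Lemma rest_connected C : continuum C -> C e -> C `<=` K -> connected (rest K C).
Proof.
move=> Cc Ce CK; have [//|[A [B [Ac Bc CA CB [KE nA nB]]]]] :=
  rest_connected_or Kc Cc CK.
exfalso; case: (e_nested Ac Bc (CA _ Ce) (CB _ Ce)) => sub.
- by apply: nB; rewrite KE; apply/seteqP; split=> [x|x [/sub|]]; [right| |].
- by apply: nA; rewrite KE; apply/seteqP; split=> [x|x [|/sub]]; [left| |].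
Qed.

Lemma rest_continuum C : continuum C -> C e -> C `<=` K -> C <> K ->
  continuum (rest K C).
Proof.
move=> Cc Ce CK nCK; apply: continuumP; first exact: rest_neq0.
  exact: rest_closed.
exact: rest_connected.
Qed.

(** If both pieces of a decomposition contained [e] they would be nested, and one
    of them would be everything. *)
Lemma decomposition_at C : continuum C -> nondegenerate C -> C `<=` K -> C e ->
  exists A B, [/\ continuum A, continuum B, C = A `|` B, A <> C /\ B <> C &
    A e /\ ~ B e].
Proof.
move=> Cc Cnd CK Ce; have [A [B [Ac Bc CE nA nB]]] := Kdec Cc Cnd CK.
have AB : A e -> B e -> False.
  move=> Ae Be; case: (e_nested Ac Bc Ae Be) => sub.
  - by apply: nB; rewrite CE; apply/seteqP; split=> [x|x [/sub|]]; [right| |].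
  - by apply: nA; rewrite CE; apply/seteqP; split=> [x|x [|/sub]]; [left| |].
move: (Ce); rewrite {1}CE => -[Ae|Be].
- by exists A, B; split=> //; split=> // Be; exact: AB.
- by exists B, A; split=> //; [rewrite setUC|split=> // Ae; exact: AB].
Qed.

Lemma collar_exists : exists C, collar C.
Proof.
have [A [B [Ac Bc KE [nA nB] [Ae nBe]]]] := decomposition_at Kc Knd (@subset_refl _ K) Ke.
exists A; split=> //; first by rewrite KE; left.
by move=> /(rest_min (continuum_closed Bc)) Be; apply: nBe; apply: Be; rewrite -KE.
Qed.

Lemma collar_total : total_on collar subset.
Proof. by move=> C D [Cc Ce _ _ _] [Dc De _ _ _]; exact: e_nested. Qed.

Lemma collar_shrink C : collar C -> exists D, [/\ collar D, D `<=` C & D <> C].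
Proof.
move=> [Cc Ce CK nCK nrC].
have Cnd : nondegenerate C.
  apply: contrapT => /(nondegenerateN Ce) C1.
  have [] := @connected_closedU_meet K C (rest K C) coK (continuum_closed Cc).
  - exact: rest_closed.
  - by apply/seteqP; split=> [x /rest_cover-/(_ C)|x [/CK|/(rest_sub cK)]].
  - by exists e.
  - exact: rest_neq0.
  - by move=> x [] + rx; rewrite C1 => xe; apply: nrC; rewrite -xe.
have [A [B [Ac Bc CE [nA nB] [Ae nBe]]]] := decomposition_at Cc Cnd CK Ce.
have AC : A `<=` C by rewrite CE; left.
exists A; split=> //; split=> //; first exact: subset_trans CK.
- by move=> AK; apply: nCK; apply/seteqP; split=> //; rewrite -AK.
- have sub : rest K A `<=` rest K C `|` B.
    apply: rest_min.
      by apply: closedU; [exact: rest_closed|exact: continuum_closed].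
    move=> x /(rest_cover C) [|rx]; last by right; left.
    by rewrite CE => -[Ax|Bx]; [left|right; right].
  by case/sub.
Qed.

(** A proper subcontinuum containing [e] is thus either a collar or nowhere dense,
    since its rest is a continuum too and nested with it if it contains [e]. *)
Lemma rest_dense C : continuum C -> C e -> C `<=` K -> C <> K -> rest K C e ->
  rest K C = K.
Proof.
move=> Cc Ce CK nCK re; apply/seteqP; split; first exact: rest_sub.
have rc := rest_continuum Cc Ce CK nCK.
case: (e_nested Cc rc Ce re) => sub x Kx.
- by case: (rest_cover C Kx) => // /sub.
- exfalso; apply: nCK; apply/seteqP; split=> // y Ky.
  by case: (rest_cover C Ky) => // /sub.
Qed.

Lemma near_end_e : near_end e. Proof. by move=> C []. Qed.

Lemma near_end_continuum : continuum near_end.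
Proof.
apply: nested_bigcap_continuum; first exact: collar_total.
- by have [C CC] := collar_exists; exists C.
- by move=> C [].
Qed.

Lemma near_end_sub C : collar C -> near_end `<=` C.
Proof. by move=> CC x; apply. Qed.

Lemma near_end_subK : near_end `<=` K.
Proof.
have [C CC] := collar_exists; have [_ _ CK _ _] := CC.
exact: subset_trans (near_end_sub CC) CK.
Qed.

Lemma near_end_neq : near_end <> K.
Proof.
have [C CC] := collar_exists; have [_ _ CK nCK _] := CC.
by move=> LK; apply: nCK; apply/seteqP; split => //; rewrite -LK; exact: near_end_sub.
Qed.

(** Were the near end a neighbourhood of [e], it would be the smallest collar, but
    collars can always be shrunk. *)
Lemma rest_near_end : rest K near_end = K.
Proof.
apply: rest_dense; [exact: near_end_continuum|exact: near_end_e|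
  exact: near_end_subK|exact: near_end_neq|].
apply: contrapT => nre.
have LC : collar near_end.
  split; [exact: near_end_continuum|exact: near_end_e|exact: near_end_subK|
    exact: near_end_neq|exact: nre].
have [D [DC DL nDL]] := collar_shrink LC.
by apply: nDL; apply/seteqP; split=> //; exact: near_end_sub.
Qed.

(** A collar [N] misses the far end: decompose the continuum [rest K N]; one of the
    two pieces misses [N], for otherwise the unions of [N] with either piece would
    be nested. Enlarging [N] by the other piece gives a collar whose rest, and with
    it the far end, lies in the piece that misses [N]. *)
Lemma far_end_collar N x : collar N -> N x -> far_end x -> False.
Proof.
move=> NC Nx Mx; have [Nc Ne NK nNK nrN] := NC.
have Bc := rest_continuum Nc Ne NK nNK.
have KE : K = N `|` rest K N.
  by apply/seteqP; split=> [y /rest_cover-/(_ N)|y [/NK|/(rest_sub cK)]].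
have [B0 _ _] := Bc.
have Bnd : nondegenerate (rest K N).
  have [z rz] := B0; apply: contrapT => /(nondegenerateN rz) rE.
  have Nz : ~ N z.
    move=> Nz; apply: nNK; rewrite KE rE; apply/seteqP; split=> [y|y [|->//]] //.
    by left.
  have [||||y [Ny]] := @connected_closedU_meet K N (rest K N) coK
    (continuum_closed Nc) => //.
  - exact: rest_closed.
  - by exists e.
  - by rewrite rE => yz; apply: Nz; rewrite -yz.
have Bsub : rest K N `<=` K by exact: rest_sub.
have [B1 [B2 [B1c B2c BE nB1 nB2]]] := Kdec Bc Bnd Bsub.
have push D D' : continuum D -> rest K N = D `|` D' -> closed D' ->
    D <> rest K N -> (forall y, N y -> ~ D' y) -> False.
  move=> Dc rE cD' nD ND'.
  have [||||y [Ny]] := @connected_closedU_meet K N (rest K N) coK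
    (continuum_closed Nc) => //.
  - exact: rest_closed.
  - by exists e.
  rewrite {1}rE => -[Dy|]; last by move/ND'.
  have CC : collar (N `|` D).
    split; [by apply: continuumU => //; exists y|by left| | |].
    - by move=> z [/NK|Dz] //; apply: Bsub; rewrite rE; left.
    - move=> CK; apply: nD; apply/seteqP; split=> z; rewrite rE; first by left.
      move=> [//|D'z]; have : K z by apply: Bsub; rewrite rE; right.
      by rewrite -CK => -[/ND'|].
    - by move=> re; apply: nrN; apply: restS re; left.
  apply: (ND' x Nx); apply: (@rest_min K (N `|` D) D' cD') (Mx _ CC).
  by rewrite {1}KE rE setUA.
have [NB1|NB2] : (forall y, N y -> ~ B1 y) \/ (forall y, N y -> ~ B2 y).
  apply: contrapT => /not_orP [/existsNP[y /not_implyP[Ny /contrapT B1y]]].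
  move=> /existsNP[z /not_implyP[Nz /contrapT B2z]].
  have aux D D' : continuum D -> rest K N = D `|` D' -> D <> rest K N ->
      N `|` D' `<=` N `|` D -> False.
    move=> Dc rE nD sub; apply: nD; apply/seteqP; split; first by rewrite rE; left.
    apply: rest_min; first exact: continuum_closed.
    rewrite {1}KE rE => w [Nw|[Dw|D'w]]; [by left|by right|].
    by apply: sub; right.
  have NB1c : continuum (N `|` B1) by apply: continuumU => //; exists y.
  have NB2c : continuum (N `|` B2) by apply: continuumU => //; exists z.
  case: (e_nested NB1c NB2c (or_introl Ne) (or_introl Ne)).
  - by apply: (aux B2 B1) => //; rewrite setUC.
  - exact: (aux B1 B2).
- by apply: (@push B2 B1) => //; [rewrite setUC|exact: continuum_closed].
- by apply: (@push B1 B2) => //; exact: continuum_closed.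
Qed.

Lemma near_far_disjoint x : near_end x -> far_end x -> False.
Proof.
have [C CC] := collar_exists => Lx; apply: (far_end_collar CC).
exact: near_end_sub Lx.
Qed.

Lemma far_end_closed : closed far_end.
Proof. by apply: closed_bigI => C _; exact: rest_closed. Qed.

Lemma far_end_sub : far_end `<=` K.
Proof.
have [C CC] := collar_exists.
by move=> x /(_ _ CC); exact: rest_sub.
Qed.

Lemma far_end_neq0 : far_end !=set0.
Proof.
pose FF := [set rest K C | C in collar].
have FFf : filtered FF.
  split; first by have [C CC] := collar_exists; exists (rest K C), C.
  move=> _ _ [C CC <-] [D DC <-].
  case: (collar_total CC DC) => CD.
  - by exists (rest K D); [exists D|move=> x rx; split=> //; exact: restS rx].
  - by exists (rest K C); [exists C|move=> x rx; split=> //; exact: restS rx].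
have [||x Fx] := filtered_bigcap_neq0 cX FFf.
- by move=> _ [C _ <-]; exact: rest_closed.
- by move=> _ [C [_ _ CK nCK _] <-]; exact: rest_neq0.
- by exists x => C CC; apply: Fx; exists C.
Qed.

Lemma far_end_irreducible N : continuum N -> N `<=` K -> N e ->
  N `&` far_end !=set0 -> N = K.
Proof.
move=> Nc NK Ne [x [Nx Mx]]; apply: contrapT => nNK.
have [re|nre] := pselect (rest K N e); last first.
  by apply: (@far_end_collar N x).
have [C CC] := collar_exists; have [Cc Ce CK nCK nrC] := CC.
apply: (far_end_collar CC _ Mx).
case: (e_nested Nc Cc Ne Ce) => [|CN]; first exact.
by exfalso; apply: nrC; exact: restS re.
Qed.

(** [N] together with the near end is all of [K], and the near end is nowhere
    dense. *)
Lemma ends_irreducible N : continuum N -> N `<=` K -> N `&` near_end !=set0 ->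
  N `&` far_end !=set0 -> N = K.
Proof.
move=> Nc NK [y [Ny Ly]] [x [Nx Mx]].
have NLK : N `|` near_end = K.
  apply: far_end_irreducible.
  - by apply: continuumU => //; [exact: near_end_continuum|exists y].
  - by move=> z [/NK|/near_end_subK].
  - by right; exact: near_end_e.
  - by exists x; split=> //; left.
apply/seteqP; split=> //; rewrite -{1}rest_near_end.
by apply: rest_min; [exact: continuum_closed|rewrite -NLK setUC].
Qed.

(** If a collar [C] omits [f], nestedness at [f] compares [rest K C] with every
    collar containing [f]; such a collar would contain both [C] and its rest. *)
Lemma nested_in_ends f : K f -> nested_at f -> near_end f \/ far_end f.
Proof.
move=> Kf f_nested; have [|nLf] := pselect (near_end f); [by left|right].
have [C CC nCf] : exists2 C, collar C & ~ C f.
  apply: contrapT => nC; apply: nLf => C CC; apply: contrapT => nCf.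
  by apply: nC; exists C.
have [Cc Ce CK nCK nrC] := CC; have Bc := rest_continuum Cc Ce CK nCK.
have rf : rest K C f by case: (rest_cover C Kf).
move=> D DC; have [Df|nDf] := pselect (D f); last by case: (rest_cover D Kf).
have [Dc De DK nDK _] := DC; exfalso; apply: nDK.
have CD : C `<=` D by case: (e_nested Cc Dc Ce De) => // /(_ _ Df).
have BD : rest K C `<=` D.
  by case: (f_nested _ _ Bc Dc rf Df) => // /(_ _ De).
by apply/seteqP; split=> // x /rest_cover-/(_ C)[/CD|/BD].
Qed.

End Ends.
End Continua.

Section Composants.
Context {R : realType} {X : metricType R}.
Hypothesis cX : compact [set: X].
Implicit Types (A B C D K N P Q O : set X) (FF : set (set X)).

Let hX : hausdorff_space X := @metric_hausdorff R X.

(** * Suslinian continua are hereditarily decomposable *)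

Lemma countable_base : exists B : nat -> set X, (forall n, open (B n)) /\
  forall O x, open O -> O x -> exists2 n, B n x & B n `<=` O.
Proof.
have [[x0 _]|X0] := pselect ([set: X] !=set0); last first.
  exists (fun=> set0); split; first by move=> _; exact: open0.
  by move=> O x; exfalso; apply: X0; exists x.
pose Xp : pseudoPMetricType R := HB.pack (Metric.sort X) (Metric.class X) (isPointed.Build (Metric.sort X) x0).
have [BB cBB [BBo BBb]] := @compact_second_countable R Xp cX.
have [f finj] := countable_injP _ cBB.
exists (fun n => \bigcup_(U in [set U | BB U /\ f U = n]) U); split.
  by move=> n; apply: (@bigcup_open X) => U [/BBo].
move=> O x oO Ox.
have [U [BU Ux] UO] : filter_from [set U | BB U /\ U x] id O.
  by apply: BBb; exact: open_nbhs_nbhs.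
exists (f U); first by exists U.
move=> y [V [BV fV] Vy]; apply: UO.
by rewrite -(finj V U) // inE.
Qed.

Lemma baire_compact (I : countType) K (D : I -> set X) : closed K -> K !=set0 ->
  (forall i, closed (D i) /\ rest K (D i) = K) ->
  exists2 x, K x & forall i, ~ D i x.
Proof.
move=> cK [x0 Kx0] Dnd.
have step (O : set X) (k : nat) : exists O' : set X, open O -> O `&` K !=set0 ->
    [/\ open O', O' `&` K !=set0, closure O' `<=` O &
      forall i, unpickle k = Some i -> forall x, closure O' x -> ~ D i x].
  have [[oO [x [Ox Kx]]]|nO] := pselect (open O /\ O `&` K !=set0); last first.
    by exists O => oO OK; case: nO.
  have shrink y (O1 : set X) : open O1 -> O1 y -> K y -> exists O' : set X,
      [/\ open O', O' `&` K !=set0 & closure O' `<=` O1].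
    move=> oO1 O1y Ky.
    have [|U [oU yU UO1]] := closed_open_shrink hX cX (@closed_point _ hX y) oO1.
      by move=> _ ->.
    by exists U; split=> //; exists y; split => //; exact: yU.
  case E : (unpickle k) => [i|].
  - have [cD rD] := Dnd i.
    have [y [[Ky nDy] Oy]] : (K `\` D i) `&` O !=set0.
      have : rest K (D i) x by rewrite rD.
      by apply; exact: open_nbhs_nbhs.
    have [O' [oO' O'K O'O]] := shrink y (O `&` ~` D i)
      (openI oO (closed_openC cD)) (conj Oy nDy) Ky.
    exists O' => _ _; split => //; first by move=> z /O'O[].
    by move=> j [<-] z /O'O[].
  - by have [O' [? ? ?]] := shrink x O oO Ox Kx; exists O'.
have [f fP] := @choice _ _ (fun p O' => open p.1 -> p.1 `&` K !=set0 ->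
    [/\ open O', O' `&` K !=set0, closure O' `<=` p.1 &
      forall i, unpickle p.2 = Some i -> forall x, closure O' x -> ~ D i x])
  (fun p => step p.1 p.2).
pose W := fix W n := if n is m.+1 then f (W m, m) else setT.
have WP n : open (W n) /\ W n `&` K !=set0.
  elim: n => [|n [oW WK]] /=; first by split; [exact: openT|exists x0].
  by have [] := fP (W n, n) oW WK.
have WS n : closure (W n.+1) `<=` W n.
  by have [oW WK] := WP n; have [] := fP (W n, n) oW WK.
have Wmono m n : (m <= n)%N -> W n `<=` W m.
  elim: n => [|n IH]; first by rewrite leqn0 => /eqP ->.
  rewrite leq_eqVlt => /predU1P[->//|]; rewrite ltnS => /IH.
  by apply: subset_trans; exact: subset_trans (@subset_closure _ _) (WS n).
have FFf : filtered (range (fun n => closure (W n) `&` K)).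
  apply: decreasing_filtered => m n mn x [Wx Kx]; split => //.
  exact: closureS (Wmono _ _ mn) _ Wx.
have [||x Fx] := filtered_bigcap_neq0 cX FFf.
- by move=> _ [n _ <-]; apply: closedI => //; exact: closed_closure.
- move=> _ [n _ <-]; have [_ [y [Wy Ky]]] := WP n.
  by exists y; split=> //; exact: subset_closure.
exists x; first by have [] := Fx _ (ex_intro2 _ _ 0%N Logic.I erefl).
move=> i; have [oW WK] := WP (pickle i).
have [_ _ _ /(_ i)] := fP (W (pickle i), pickle i) oW WK; apply.
  by rewrite /= pickleK.
by have [] := Fx _ (ex_intro2 _ _ (pickle i).+1 Logic.I erefl).
Qed.

(** A weak form of the boundary bumping theorem. Take the component of [p] in the
    complement of a neighbourhood of some other point; were it degenerate, [p]
    would have a small clopen neighbourhood in the connected set [K]. *)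
Lemma proper_subcontinuum K p : continuum K -> nondegenerate K -> K p ->
  exists D, [/\ continuum D, nondegenerate D, D `<=` K, D <> K & D p].
Proof.
move=> Kc Knd Kp; have cK := continuum_closed Kc; have [_ _ coK] := Kc.
have [q Kq qp] : exists2 q, K q & q <> p.
  have [x [y [Kx Ky xy]]] := Knd; have [xp|] := pselect (x = p); last by exists x.
  by exists y => // yp; apply: xy; rewrite xp yp.
have [|||U [V [oU oV pU qV UV]]] := @closed_disjoint_open _ hX cX [set p] [set q].
- exact: closed_point.
- exact: closed_point.
- by move=> x -> /esym.
have Up : U p by exact: pU.
have Vq : V q by exact: qV.
pose Z := K `\` V; have cZ : closed Z.
  by rewrite /Z setDE; apply: closedI => //; exact: open_closedC.
have Zp : Z p by split=> // Vp; exact: (UV p).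
have CZ := @connected_component_sub _ Z p.
have Cp := connected_component_refl Zp.
have Cc : continuum (connected_component Z p).
  by apply: continuumP => //; [exists p|exact: component_closed|exact: component_connected].
exists (connected_component Z p); split => //.
- apply: contrapT => /(nondegenerateN Cp) C1.
  have [|P [Q [[cP cQ] ZE dis Pp PU]]] := component_clopen_trace hX cX cZ Zp oU.
    by rewrite C1.
  have /(_ q Kq)/PU Uq : K `<=` P.
    apply: (connected_closed_split coK cP (closedU cQ (@closed_closure _ V))).
    + move=> x Kx; have [Vx|nVx] := pselect (V x).
        by right; right; exact: subset_closure.
      have : Z x by split.
      by rewrite ZE => -[]; [left|right; left].
    + move=> x _ Px [Qx|clVx]; first exact: (dis x).
      have [y [Vy Uy]] := clVx U (open_nbhs_nbhs (conj oU (PU _ Px))).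
      exact: (UV y).
    + by exists p.
  exact: (UV q).
- by move=> x /CZ [].
- by move=> CK; move: Kq; rewrite -CK => /CZ [].
Qed.

(** The composants of an indecomposable [K] are the classes of the relation [same]
    below. Each of them is a union of countably many proper subcontinua, namely of
    components of complements of basic open sets, and these are nowhere dense. *)
Lemma suslinian_decomposable K : Suslinian X -> continuum K -> nondegenerate K ->
  decomposable K.
Proof.
move=> susX Kc Knd; apply: contrapT => Kind.
have cK := continuum_closed Kc; have [[x0 Kx0] _ coK] := Kc.
pose proper D := [/\ continuum D, D `<=` K & D <> K].
have properU C D : proper C -> proper D -> C `&` D !=set0 -> proper (C `|` D).
  move=> [Cc CK nCK] [Dc DK nDK] CD; split; first exact: continuumU.
    by move=> x [/CK|/DK].
  by move=> CDK; apply: Kind; exists C, D; split=> //; rewrite CDK.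
(* For indecomposable [K] the rest of a proper subcontinuum is connected, and as
   second piece of a decomposition it must be all of [K]. *)
have nowhere_dense D : proper D -> rest K D = K.
  move=> [Dc DK nDK]; have [coB|[A [B [Ac Bc _ _ [KE nA nB]]]]] :=
    rest_connected_or cX Kc Dc DK; last by exfalso; apply: Kind; exists A, B.
  apply: contrapT => nrK; apply: Kind; exists D, (rest K D); split=> //.
  - apply: continuumP => //; [exact: rest_neq0|exact: rest_closed].
  - by apply/seteqP; split=> [x /rest_cover-/(_ D)|x [/DK|/(rest_sub cK)]].
pose same p q := exists D, [/\ proper D, D p & D q].
have same_sym p q : same p q -> same q p by move=> [D [? ? ?]]; exists D.
have same_trans q p r : same p q -> same q r -> same p r.
  move=> [D [Dp Dp0 Dq]] [D' [D'p D'q D'r]]; exists (D `|` D'); split; [|by left|by right].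
  by apply: properU => //; exists q.
have Dex p : exists D, K p -> [/\ proper D, nondegenerate D & D p].
  have [Kp|nKp] := pselect (K p); last by exists set0.
  by have [D [? ? ? ? ?]] := proper_subcontinuum Kc Knd Kp; exists D.
have [Df DfP] := choice Dex.
have same_refl p : K p -> same p p.
  by move=> Kp; have [Dp _ Dpp] := DfP p Kp; exists (Df p).
(* [xget] depends on the set only, so all points of a composant have the same
   representative. *)
pose rep p := xget x0 (same p).
have repP p : K p -> same p (rep p).
  by move=> Kp; apply: (@xgetPex _ x0 (same p)); exists p; exact: same_refl.
have sameK p q : same p q -> K q by move=> [D [[_ DK _] _ /DK]].
have rep_eq p q : same p q -> rep p = rep q.
  move=> pq; congr (xget x0 _); apply/seteqP; split=> r.
    exact: same_trans (same_sym _ _ pq).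
  exact: same_trans pq.
pose CC := [set Df (rep p) | p in K].
apply: susX; exists CC; split; last 2 first.
- move=> _ [p Kp <-]; have Kr := sameK _ _ (repP p Kp).
  by have [[]] := DfP _ Kr.
- move=> _ _ [p Kp <-] [q Kq <-] [z [zp zq]]; congr (Df _).
  have Krp := sameK _ _ (repP p Kp); have Krq := sameK _ _ (repP q Kq).
  have [Dp _ Dpp] := DfP _ Krp; have [Dq _ Dqq] := DfP _ Krq.
  apply: rep_eq; apply: (same_trans _ _ _ (repP p Kp)).
  apply: (same_trans z); first by exists (Df (rep p)).
  apply: (same_trans (rep q)); first by exists (Df (rep q)).
  exact: same_sym (repP q Kq).
move=> cCC.
have [g ginj] := countable_injP _ cCC.
have [B [oB Bbase]] := countable_base.
pose pt m := xget x0 (\bigcup_(D in [set D | CC D /\ g D = m]) D).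
pose F (i : nat * nat) := if `[< K `&` B i.2 !=set0 >]
  then connected_component (K `\` B i.2) (pt i.1) else set0.
have [i|p Kp nF] := @baire_compact (nat * nat)%type K F cK (ex_intro _ x0 Kx0).
  rewrite /F; case: asboolP => [[z [Kz Bz]]|_]; last first.
    by split; [exact: closed0|rewrite /rest setD0 -(closure_id _).1].
  have cKB : closed (K `\` B i.2).
    by rewrite setDE; apply: closedI => //; exact: open_closedC.
  split; first exact: component_closed.
  have [Zp|nZp] := pselect ((K `\` B i.2) (pt i.1)); last first.
    by rewrite connected_component_out// /rest setD0 -(closure_id _).1.
  apply: nowhere_dense; split.
  - apply: continuumP => //; [|exact: component_closed|exact: component_connected].
    by exists (pt i.1); exact: connected_component_refl.
  - by move=> y /connected_component_sub[].
  - by move=> CK; move: Kz; rewrite -CK => /connected_component_sub[].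
have Kr := sameK _ _ (repP p Kp); have [Dp _ Dpp] := DfP _ Kr.
have Dpt : Df (rep p) (pt (g (Df (rep p)))).
  have [D [CD gD] Dx] : (\bigcup_(D in [set D | CC D /\ g D = g (Df (rep p))]) D)
      (pt (g (Df (rep p)))).
    apply: (@xgetPex _ x0); exists (rep p), (Df (rep p)) => //.
    by split=> //; exists p.
  have CDp : CC (Df (rep p)) by exists p.
  by rewrite -{1}(ginj D (Df (rep p)) (mem_set CD) (mem_set CDp) gD).
have [E [[Ec EK nEK] Ep Ept]] : same p (pt (g (Df (rep p)))).
  by apply: (same_trans _ _ _ (repP p Kp)); exists (Df (rep p)).
have [z Kz nEz] : exists2 z, K z & ~ E z.
  apply: contrapT => nz; apply: nEK; apply/seteqP; split=> // z Kz.
  by apply: contrapT => nEz; apply: nz; exists z.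
have [n Bz BE] := Bbase _ z (closed_openC (continuum_closed Ec)) nEz.
apply: (nF (g (Df (rep p)), n)); rewrite /F /=.
have -> : `[< K `&` B n !=set0 >] by apply/asboolP; exists z.
exists E => //; split=> //; last by case: Ec.
by move=> y Ey; split; [exact: EK|move=> /BE].
Qed.

End Composants.

Section Chains.
Context {R : realType} {X : metricType R}.
Hypothesis cX : compact [set: X].
Implicit Types (A B C D K P Q O : set X) (FF : set (set X)).

Let hX : hausdorff_space X := @metric_hausdorff R X.

(** * Chains and endpoints *)

(** Chains without the requirements that the sequence is finite and that links and
    intersections of neighbours are nonempty. These are free in a compact connected
    space ([linear_cover_chain]) and would be a burden in the constructions. *)
Definition linear_cover (eps : R) (U : nat -> set X) :=
  [/\ forall i, open (U i), forall x, exists i, U i x,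
      forall i x y, U i x -> U i y -> mdist x y < eps &
      forall i j x, (i.+1 < j)%N -> U i x -> U j x -> False].

Lemma linear_coverW eps eps' U : eps <= eps' -> linear_cover eps U ->
  linear_cover eps' U.
Proof.
move=> le [oU cU dU fU]; split=> // i x y Ux Uy.
exact: lt_le_trans (dU i x y Ux Uy) le.
Qed.

Lemma chain_linear_cover eps n (U : 'I_n.+1 -> set X) : is_chain eps U ->
  exists V, linear_cover eps V /\ V 0%N = U ord0.
Proof.
move=> [oU cU dU fU].
exists (fun i => \bigcup_(k in [set k : 'I_n.+1 | k = i :> nat]) U k).
split; last first.
  apply/seteqP; split=> [x [k /= k0 Ux]|x Ux]; last by exists ord0.
  by rewrite (_ : ord0 = k)//; exact: val_inj.
split.
- by move=> i; apply: bigcup_open => k _.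
- move=> x; have : [set: X] x by [].
  by rewrite -cU => -[k _ Ukx]; exists k, k.
- move=> i x y [k /= ki Ukx] [k' /= k'i Uky].
  have kk : k' = k by apply: val_inj; rewrite /= ki k'i.
  rewrite kk in Uky; rewrite -lte_fin; apply: le_lt_trans (dU k).
  by apply: ereal_sup_ubound; exists x => //; exists y.
- move=> i j x ij [k /= ki Ukx] [k' /= k'j Ukx'].
  have /fU : U k `&` U k' !=set0 by exists x.
  rewrite ki k'j; lia.
Qed.

Lemma linear_cover_bound eps U : linear_cover eps U ->
  exists N, forall i x, U i x -> (i <= N)%N.
Proof.
move=> [oU cU _ fU].
pose F n := ~` \bigcup_(i in [set i | (i < n)%N]) U i.
have FS m n : (m <= n)%N -> F n `<=` F m.
  by move=> mn x nx [i /= im Ux]; apply: nx; exists i => //=; exact: leq_trans mn.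
have Ff := decreasing_filtered FS.
have [||_ [n _ <-] Fn] := filtered_bigcap_open cX Ff _ open0.
- by move=> _ [n _ <-]; apply: open_closedC; apply: bigcup_open.
- move=> x Fx; have [i Ux] := cU x.
  apply: (Fx (F i.+1) (ex_intro2 _ _ i.+1 Logic.I erefl)).
  by exists i => /=.
exists n => i x Ux; rewrite leqNgt; apply/negP => ni.
have [j /= jn Ujx] : (\bigcup_(i in [set i | (i < n)%N]) U i) x.
  by apply: contrapT => nx; exact: (Fn x).
by apply: (fU j i x) => //; lia.
Qed.

(** Cut the cover at its first gap: in a connected space the links beyond the gap,
    being disjoint from those before it, are empty. The mesh is halved because a
    diameter is a supremum and has to be strictly less than [eps]. *)
Lemma linear_cover_chain eps U x : connected [set: X] -> 0 < eps ->
  linear_cover (eps / 2) U -> U 0%N x ->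
  exists n (V : 'I_n.+1 -> set X), is_chain eps V /\ V ord0 x.
Proof.
move=> coX eps0 lU Ux; have [N UN] := linear_cover_bound lU.
have [oU cU dU fU] := lU.
have gap : exists m, `[< ~ (U m `&` U m.+1 !=set0) >].
  by exists N; apply/asboolP => -[y [_ /UN]]; rewrite ltnn.
case: (ex_minnP gap) => m /asboolP mgap mmin.
have meet i : (i < m)%N -> U i `&` U i.+1 !=set0.
  move=> im; apply: contrapT => ni.
  have /mmin : `[< ~ (U i `&` U i.+1 !=set0) >] by exact/asboolP.
  by rewrite leqNgt im.
have cover y : exists2 i, (i <= m)%N & U i y.
  pose O1 := \bigcup_(i in [set i | (i <= m)%N]) U i.
  pose O2 := \bigcup_(i in [set i | (m < i)%N]) U i.
  have /(_ y Logic.I) [i im Uy] : [set: X] `<=` O1; last by exists i.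
  apply: (connected_open_split coX (_ : open O1) (_ : open O2)).
  - by apply: bigcup_open.
  - by apply: bigcup_open.
  - move=> z _; have [i Uz] := cU z.
    by case: (leqP i m) => im; [left|right]; exists i.
  - move=> z _ [i /= im Uiz] [j /= mj Ujz].
    have [ij|ij] := ltnP i.+1 j; first exact: (fU i j z).
    have [im' jm] : i = m /\ j = m.+1 by lia.
    by apply: mgap; exists z; rewrite -{1}im' -jm.
  - by exists x => //; exists 0%N.
have ne i : (i <= m)%N -> U i !=set0.
  case: i => [|i] im; first by exists x.
  by have [y [_ Uy]] := meet i im; exists y.
exists m, (fun k : 'I_m.+1 => U k); split=> //; split=> //.
- apply/seteqP; split=> // y _; have [i im Uy] := cover y.
  by exists (Ordinal (im : (i < m.+1)%N)).
- move=> i; apply: (@le_lt_trans _ _ (eps / 2)%:E); last first.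
    by rewrite lte_fin ltr_pdivrMr// ltr_pMr// ltr1n.
  apply: ge_ereal_sup => _ [y Uy [z Uz <-]].
  by rewrite lee_fin ltW//; exact: (dU i).
- move=> i j; split=> [[y [Uiy Ujy]]|ij].
    have h1 : ~ (i.+1 < j)%N by move=> h; exact: (fU i j y).
    have h2 : ~ (j.+1 < i)%N by move=> h; exact: (fU j i y).
    lia.
  have [im jm] := (ltn_ord i, ltn_ord j).
  have [E|[E|E]] : i = j :> nat \/ (j = i.+1 :> nat \/ i = j.+1 :> nat) by lia.
  + by have [y Uy] := ne i im; exists y; rewrite -E.
  + by rewrite E; apply: meet; lia.
  + by rewrite E setIC; apply: meet; lia.
Qed.

Lemma linear_cover_through eps U B i j k : linear_cover eps U -> connected B ->
  B `&` U i !=set0 -> B `&` U j !=set0 -> (i <= k <= j)%N -> B `&` U k !=set0.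
Proof.
move=> [oU cU dU fU] coB [x [Bx Ux]] [y [By Uy]] /andP[ik kj].
apply: contrapT => Bk.
have nk z : B z -> U k z -> False by move=> Bz Uz; apply: Bk; exists z.
have il : (i < k)%N.
  by rewrite ltn_neqAle ik andbT; apply/eqP => E; apply: (nk x); rewrite -?E.
have lj : (k < j)%N.
  by rewrite ltn_neqAle kj andbT; apply/eqP => E; apply: (nk y); rewrite ?E.
pose O1 := \bigcup_(i in [set i | (i < k)%N]) U i.
pose O2 := \bigcup_(i in [set i | (k < i)%N]) U i.
have dis z : O1 z -> O2 z -> False.
  by move=> [i' /= i'k Uz] [j' /= kj' Uz']; apply: (fU i' j' z) => //; lia.
have /(_ y By) O1y : B `<=` O1.
  apply: (connected_open_split coB (_ : open O1) (_ : open O2)).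
  - by apply: bigcup_open.
  - by apply: bigcup_open.
  - move=> z Bz; have [l Uz] := cU z.
    case: (ltngtP l k) => lk; [by left; exists l|by right; exists l|].
    by exfalso; apply: (nk z) => //; rewrite -lk.
  - by move=> z _; exact: dis.
  - by exists x => //; exists i.
by apply: (dis y) => //; exists j.
Qed.

Lemma closed_dist_gt0 B x : closed B -> ~ B x ->
  exists2 d : R, 0 < d & forall y, B y -> d <= mdist x y.
Proof.
move=> cB nBx.
have : nbhs x (~` B) by apply: open_nbhs_nbhs; split => //; exact: closed_openC.
rewrite -nbhs_ballE => -[d /= d0 dB]; exists d => // y By.
rewrite leNgt; apply/negP => yd; apply: (dB y) => //.
by rewrite ballEmdist.
Qed.

(** If [a] in [A] and [b] in [B] witness that [A] and [B] are not nested, take a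
    chain from [x] whose mesh is less than the distances from [a] to [B] and from
    [b] to [A]. Of [a] and [b], let [a] be in the earlier link; on its way from [x]
    to [b], the connected set [B] meets that link. *)
Lemma endpoint_nested x : endpoints X x -> nested_at x.
Proof.
move=> Ex A B Ac Bc Ax Bx; apply: contrapT => /not_orP[].
move=> /existsNP[a /not_implyP[Aa nBa]] /existsNP[b /not_implyP[Bb nAb]].
have [d1 d10 dB] := closed_dist_gt0 (continuum_closed Bc) nBa.
have [d2 d20 dA] := closed_dist_gt0 (continuum_closed Ac) nAb.
have d0 : 0 < Num.min d1 d2 by rewrite lt_min d10.
have [n [U [/chain_linear_cover[V [lV V0]] Ux]]] := Ex _ d0.
rewrite -V0 in Ux; have [_ cV dV _] := lV.
have [[i Via] [j Vjb]] := (cV a, cV b).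
have [_ _ coA] := Ac; have [_ _ coB] := Bc.
have [ij|ji] := leqP i j.
- have [|||y [By Viy]] := @linear_cover_through _ V B 0%N j i lV coB.
  + by exists x.
  + by exists b.
  + by rewrite ij.
  have := dV i a y Via Viy; rewrite lt_min => /andP[+ _].
  by rewrite ltNge dB.
- have [|||y [Ay Vjy]] := @linear_cover_through _ V A 0%N i j lV coA.
  + by exists x.
  + by exists a.
  + by lia.
  have := dV j b y Vjb Vjy; rewrite lt_min => /andP[_].
  by rewrite ltNge dA.
Qed.

Lemma lebesgue_number (U : nat -> set X) : (forall i, open (U i)) ->
  (forall x, exists i, U i x) ->
  exists2 d : R, 0 < d & forall x, exists i, forall y, mdist x y < d -> U i y.
Proof.
move=> oU cU.
pose S (d : R) := [set x | forall i, ~ (forall y, mdist x y < d -> U i y)].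
have SS (c d : R) : c <= d -> S c `<=` S d.
  move=> cd x Sx i Ux; apply: (Sx i) => y xy; apply: Ux.
  exact: lt_le_trans xy cd.
pose FF := [set closure (S d) | d in [set d : R | 0 < d]].
have FFf : filtered FF.
  split; first by exists (closure (S 1)), 1 => //=; exact: ltr01.
  move=> _ _ [c /= c0 <-] [d /= d0 <-]; exists (closure (S (Num.min c d))).
    by exists (Num.min c d); rewrite //= lt_min c0.
  by move=> x Sx; split; apply: closureS Sx; apply: SS; rewrite ge_min lexx ?orbT.
have [||_ [d /= d0 <-] Sd] := filtered_bigcap_open cX FFf _ open0.
- by move=> _ [d _ <-]; exact: closed_closure.
- move=> x Fx; have [i Ux] := cU x.
  have : nbhs x (U i) by apply: open_nbhs_nbhs.
  rewrite -nbhs_ballE => -[d /= d0 dU].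
  have d20 : 0 < d / 2 by rewrite divr_gt0.
  have clx : closure (S (d / 2)) x by apply: Fx; exists (d / 2).
  have [z [Sz]] := clx _ (nbhsx_ballx x _ d20).
  rewrite ballEmdist /= => xz; apply: (Sz i) => y zy; apply: dU.
  rewrite ballEmdist /=; apply: le_lt_trans (metric_triangle x z y) _.
  by rewrite (splitr d) ltrD.
exists d => // x; apply: contrapT => nx.
apply: (Sd x); apply: subset_closure => i Ux; apply: nx; by exists i.
Qed.


(** * Existence of an endpoint *)

Definition starts_chains A := forall eps : R, 0 < eps ->
  exists2 U, linear_cover eps U & A `&` U 0%N !=set0.

(** For continua this is equivalent to [starts_chains], by the two lemmas below; it
    has the advantage that it visibly passes to nested intersections. *)
Definition initial_set A := forall (eps : R) O, 0 < eps -> open O -> A `<=` O ->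
  exists U k, [/\ linear_cover eps U,
    forall x, A x -> exists2 i, (i < k)%N & U i x &
    forall i x, (i < k)%N -> U i x -> O x].

Lemma linear_cover_span eps U A : linear_cover eps U -> continuum A ->
  exists a b, [/\ (a <= b)%N, forall i, (a <= i <= b)%N -> A `&` U i !=set0 &
    forall i x, A x -> U i x -> (a <= i <= b)%N].
Proof.
move=> lU [[x0 Ax0] _ coA]; have [N UN] := linear_cover_bound lU.
have [_ cU _ _] := lU.
pose hit i := `[< A `&` U i !=set0 >].
have hitP i x : A x -> U i x -> hit i by move=> Ax Ux; apply/asboolP; exists x.
have ex : exists i, hit i by have [i /(hitP _ _ Ax0)] := cU x0; exists i.
have ub i : hit i -> (i <= N)%N by move=> /asboolP[x [_ /UN]].
case: (ex_minnP ex) => a ha amin; case: (ex_maxnP ex ub) => b hb bmax.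
exists a, b; split; first exact: bmax.
- by move=> i iab; apply: (linear_cover_through lU coA _ _ iab); apply/asboolP.
- by move=> i x Ax Ux; rewrite amin ?bmax //; apply: hitP Ux.
Qed.

(** If the first link meets [A], the links that meet [A] form an initial segment,
    and for small mesh they lie close to [A]. *)
Lemma starts_chains_initial A : continuum A -> starts_chains A -> initial_set A.
Proof.
move=> Ac sA eps O eps0 oO AO; have cA := continuum_closed Ac.
pose G i := if i is 0%N then O else ~` A.
(* A Lebesgue number of the cover by [O] and [~` A] is a distance from [A] within
   which all points belong to [O]. *)
have [||d d0 dG] := @lebesgue_number G.
- by case=> [//|i]; exact: closed_openC.
- move=> x; have [Ax|nAx] := pselect (A x); first by exists 0%N; exact: AO.
  by exists 1%N.
have m0 : 0 < Num.min eps d by rewrite lt_min eps0.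
have [U lU [x0 [Ax0 Ux0]]] := sA _ m0.
have [_ cU dU _] := lU.
have [a [b [ab Aab abA]]] := linear_cover_span lU Ac.
have a0 : a = 0%N by have := abA 0%N x0 Ax0 Ux0; lia.
exists U, b.+1; split.
- by apply: linear_coverW lU; rewrite ge_min lexx.
- move=> x Ax; have [i Ux] := cU x; exists i => //.
  by have := abA i x Ax Ux; lia.
- move=> i x ib Ux; have [|y [Ay Uy]] := Aab i; first by lia.
  have [[|j] jG] := dG y.
    apply: (jG x); apply: lt_le_trans (dU i y x Uy Ux) _.
    by rewrite ge_min lexx orbT.
  by exfalso; apply: (jG y) => //; rewrite mdistxx.
Qed.

(** Refine a coarse chain [c0], in which [A] occupies the links from [a] to [b], by
    a chain [e] that begins by running through [A] inside those links; let [W] be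
    the part of [e] before it first leaves them. The chain wanted consists of the
    links from [a] to [b] cut down to [W], followed by the remainder of [e]. All
    its links of the first kind meet [A]. As [e] can leave only next to the link
    [b] or next to the link [a], the links of the first kind have to be taken in
    increasing or in decreasing order. *)
Lemma initial_starts_chains A : continuum A -> initial_set A -> starts_chains A.
Proof.
move=> Ac iA eps eps0; have [c0 [_ [lc _ _]]] := iA eps setT eps0 openT (@subsetT _ _).
have [oc cc dc fc] := lc.
have [a [b [ab Aab abA]]] := linear_cover_span lc Ac.
pose O := \bigcup_(i in [set i | (a <= i <= b)%N]) c0 i.
have oO : open O by apply: bigcup_open.
have AO : A `<=` O.
  by move=> x Ax; have [i cx] := cc x; exists i => //=; exact: abA cx.
have [d d0 dc0] := lebesgue_number oc cc.
have m0 : 0 < Num.min eps d by rewrite lt_min eps0.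
have [e [k [le Ae eO]]] := iA _ O m0 oO AO.
have {}le' : linear_cover eps e by apply: linear_coverW le; rewrite ge_min lexx.
have [oe ce de fe] := le.
(* The new chain, for a remainder [t] and an order [s] in which to run through the
   coarse links. *)
have main (W : set X) (t : nat -> set X) (s : nat -> nat) :
    open W -> A `<=` W -> W `<=` O ->
    (forall i j, (i.+1 < j)%N -> (j <= b - a)%N ->
      ((s i).+1 < s j)%N || ((s j).+1 < s i)%N) ->
    (forall i, (a <= i <= b)%N -> exists2 j, (j <= b - a)%N & s j = i) ->
    (a <= s 0%N <= b)%N ->
    (forall j, open (t j)) -> (forall x, W x \/ exists j, t j x) ->
    (forall j x y, t j x -> t j y -> mdist x y < eps) ->
    (forall i j x, (i.+1 < j)%N -> t i x -> t j x -> False) ->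
    (forall j x, t j.+1 x -> W x -> False) ->
    (forall i x, (i < b - a)%N -> c0 (s i) x -> t 0%N x -> False) ->
    exists2 U, linear_cover eps U & A `&` U 0%N !=set0.
  move=> oW AW WO sfar sonto s0 ot ct dt ft tW t0.
  exists (fun i => if (i <= b - a)%N then c0 (s i) `&` W else t (i - (b - a).+1)%N).
    split.
    - by move=> i; case: ifP => _ //; exact: openI.
    - move=> x; have [Wx|[j tx]] := ct x.
        have [i /= iab cx] := WO _ Wx; have [j jab sj] := sonto i iab.
        by exists j; rewrite jab sj.
      exists (j + (b - a).+1)%N; rewrite addnK.
      by rewrite (_ : (_ <= _)%N = false)//; lia.
    - move=> i x y; case: ifP => _; last exact: dt.
      by move=> [cx _] [cy _]; exact: (dc (s i)).
    - move=> i j x ij; case: ifP => ib; case: ifP => jb.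
      + move=> [cix _] [cjx _].
        by case/orP: (sfar i j ij jb) => h; [exact: (fc (s i) (s j) x)|exact: (fc (s j) (s i) x)].
      + move=> [cx Wx]; case E : (j - (b - a).+1)%N => [|l] tx; last exact: (tW l x).
        by apply: (t0 i x) => //; lia.
      + by lia.
      + by apply: ft; lia.
  by rewrite leq0n; have [x [Ax cx]] := Aab _ s0; exists x; split=> //; split=> //; exact: AW.
have [allO|] := pselect (forall i, e i `<=` O).
  apply: (main setT (fun=> set0) (fun i => a + i)%N) => //.
  - exact: openT.
  - by move=> x _; have [i ex] := ce x; exact: (allO i).
  - by move=> i j ij jb; lia.
  - by move=> i iab; exists (i - a)%N; lia.
  - by lia.
  - by move=> j; exact: open0.
  - by move=> x; left.
move=> /existsNP exN.
(* [K] is the first index at which [e] leaves the links from [a] to [b]. *)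
have exK : exists i, `[< ~ (e i `<=` O) >] by have [i ?] := exN; exists i; apply/asboolP.
case: (ex_minnP exK) => K /asboolP /existsNP[z /not_implyP[ez nOz]] Kmin.
have eK i : (i < K)%N -> e i `<=` O.
  move=> iK; apply: contrapT => ni.
  have /Kmin : `[< ~ (e i `<=` O) >] by exact/asboolP.
  by rewrite leqNgt iK.
have kK : (k <= K)%N.
  by rewrite leqNgt; apply/negP => Kk; apply: nOz; exact: (eO K).
pose W := \bigcup_(i in [set i | (i < K)%N]) e i.
have oW : open W by apply: bigcup_open.
have AW : A `<=` W.
  by move=> x /Ae[i ik ex]; exists i => //=; exact: leq_trans kK.
have WO : W `<=` O by move=> x [i /= iK ex]; exact: (eK i).
have [y ey] : exists y, e K `<=` c0 y.
  have [y dy] := dc0 z; exists y => x ex; apply: dy.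
  by apply: lt_le_trans (de K z x ez ex) _; rewrite ge_min lexx orbT.
have nyab : ~~ (a <= y <= b)%N.
  by apply/negP => yab; apply: nOz; exists y => //; exact: ey.
have tcov x : W x \/ exists j, e (K + j)%N x.
  have [i ex] := ce x; have [iK|Ki] := ltnP i K; first by left; exists i.
  by right; exists (i - K)%N; rewrite subnKC.
have tW j x : e (K + j.+1)%N x -> W x -> False.
  by move=> ex [i /= iK eix]; apply: (fe i (K + j.+1)%N x) => //; lia.
have tdi j x x' : e (K + j)%N x -> e (K + j)%N x' -> mdist x x' < eps.
  by have [_ _ de' _] := le'; exact: de'.
have tfar i j x : (i.+1 < j)%N -> e (K + i)%N x -> e (K + j)%N x -> False.
  by move=> ij; apply: fe; lia.
have [yb|yb] := ltnP b y.
- apply: (main W (fun j => e (K + j)%N) (fun i => a + i)%N) => //.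
  - by move=> i j ij jb; lia.
  - by move=> i iab; exists (i - a)%N; lia.
  - by lia.
  - move=> i x iba cx; rewrite addn0 => /ey cyx.
    by apply: (fc (a + i)%N y x) => //; lia.
- apply: (main W (fun j => e (K + j)%N) (fun i => b - i)%N) => //.
  - by move=> i j ij jb; lia.
  - by move=> i iab; exists (b - i)%N; lia.
  - by lia.
  - move=> i x iba cx; rewrite addn0 => /ey cyx.
    by apply: (fc y (b - i)%N x) => //; lia.
Qed.

Lemma starts_chainsU P Q : starts_chains (P `|` Q) ->
  starts_chains P \/ starts_chains Q.
Proof.
move=> sPQ; apply: contrapT => /not_orP[].
move=> /existsNP[d1 /not_implyP[d10 nP]] /existsNP[d2 /not_implyP[d20 nQ]].
have m0 : 0 < Num.min d1 d2 by rewrite lt_min d10.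
have [U lU [x [PQx Ux]]] := sPQ _ m0.
case: PQx => [Px|Qx].
- apply: nP; exists U; last by exists x.
  by apply: linear_coverW lU; rewrite ge_min lexx.
- apply: nQ; exists U; last by exists x.
  by apply: linear_coverW lU; rewrite ge_min lexx orbT.
Qed.

(** Zorn's lemma is applied to complements, as it provides maximal sets. *)
Lemma endpoint_exists : continuum [set: X] -> chainable X ->
  (forall K, continuum K -> nondegenerate K -> decomposable K) ->
  exists x, endpoints X x.
Proof.
move=> Xc chX Xdec.
have coX : connected [set: X] by case: Xc.
pose good B := continuum (~` B) /\ starts_chains (~` B).
have [|B [[Ac sA] Bmax]] := @Zorn_bigcup X good.
  move=> F FP tF; have [[B0 FB0]|F0] := pselect (F !=set0); last first.
    rewrite /good (_ : \bigcup_(B in F) B = set0) ?setC0; last first.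
      by apply/seteqP; split=> // x [B FB _]; apply: F0; exists B.
    split=> // eps eps0.
    have [n [U UC]] := chX _ eps0.
    have [y [Uy _]] : U ord0 `&` U ord0 !=set0.
      by have [_ _ _ fU] := UC; apply/fU; lia.
    have [V [lV V0]] := chain_linear_cover UC.
    by exists V => //; exists y; rewrite V0.
  pose FF := [set ~` B | B in F].
  have IE : ~` (\bigcup_(B in F) B) = \bigcap_(A in FF) A.
    rewrite setC_bigcup; apply/seteqP; split=> [x Fx _ [B FB <-]|x Fx B FB].
      exact: Fx.
    by apply: Fx; exists B.
  have FF0 : FF !=set0 by exists (~` B0), B0.
  have tFF : total_on FF subset.
    move=> _ _ [B FB <-] [C FC <-].
    by case: (tF B C FB FC) => BC; [right|left]; exact: subsetC.
  have FFc A : FF A -> continuum A by move=> [B /FP[Bc _] <-].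
  have Ic := nested_bigcap_continuum cX tFF FF0 FFc.
  rewrite /good IE; split=> //; apply: initial_starts_chains => //.
  move=> eps O eps0 oO IO.
  have [|_ [B FB <-] BO] := filtered_bigcap_open cX (total_on_filtered FF0 tFF) _ oO IO.
    by move=> A /FFc; exact: continuum_closed.
  have [Bc sB] := FP _ FB.
  have [U [k [lU Uk UO]]] := starts_chains_initial Bc sB eps0 oO BO.
  exists U, k; split=> // x Ix; apply: Uk; apply: Ix; by exists B.
have [And|nA] := pselect (nondegenerate (~` B)); last first.
  have [[x Bx] _ _] := Ac; exists x => eps eps0.
  have [|U lU [y [By Uy]]] := sA (eps / 2); first by rewrite divr_gt0.
  rewrite (nondegenerateN Bx nA) in By; rewrite By in Uy.
  exact: linear_cover_chain lU Uy.
exfalso; have [P [Q [Pc Qc BE nP nQ]]] := Xdec _ Ac And.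
have smaller P' : continuum P' -> starts_chains P' -> P' `<=` ~` B -> P' <> ~` B -> False.
  move=> P'c sP' sub neq; apply: (Bmax (~` P')); last by rewrite /good setCK.
  split; first by move=> x Bx P'x; exact: (sub x).
  move=> sub'; apply: neq; apply/seteqP; split=> // x nBx.
  by apply: contrapT => nP'x; apply: nBx; exact: sub'.
rewrite {1}BE in sA; case: (starts_chainsU sA) => s.
- by apply: (smaller P) => //; rewrite BE; left.
- by apply: (smaller Q) => //; rewrite BE; right.
Qed.

End Chains.

Section CantorScheme.
Context {R : realType} {X : metricType R}.
Hypothesis cX : compact [set: X].
Implicit Types (A B C D K P Q O N F : set X) (FF : set (set X)).

Let hX : hausdorff_space X := @metric_hausdorff R X.

(** * Cantor schemes of large continua *)

Definition wider_than (d : R) A := exists x y, [/\ A x, A y & d < mdist x y].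

Lemma wider_nondegenerate d A : 0 <= d -> wider_than d A -> nondegenerate A.
Proof.
move=> d0 [x [y [Ax Ay dxy]]]; exists x, y; split => // xy.
by move: dxy; rewrite xy mdistxx ltNge d0.
Qed.

(** A cluster point of a sequence of pairs, stated without the product topology. *)
Lemma cluster_pair (u v : nat -> X) : exists x y : X, forall A B n,
  nbhs x A -> nbhs y B -> exists m, [/\ (n <= m)%N, A (u m) & B (v m)].
Proof.
have cXX := compact_setX cX cX.
pose G := filter_from [set: nat]
  (fun n => [set (u m, v m) | m in [set m | (n <= m)%N]]).
have PG : ProperFilter G.
  apply: filter_from_proper; last by move=> n _; exists (u n, v n), n => /=.
  apply: filter_from_filter; first by exists 0%N.
  move=> m n _ _; exists (maxn m n) => // _ [k /= mnk <-].
  by split; exists k => //=; apply: leq_trans mnk; rewrite ?leq_maxl ?leq_maxr.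
have [|[x y] [_ clxy]] := cXX _ PG.
  by apply: filterS (@filterT _ G _).
exists x, y => A B n nA nB.
have Gn : G [set (u m, v m) | m in [set m | (n <= m)%N]] by exists n.
have nAB : nbhs (x, y) (A `*` B) by exists (A, B).
by have [_ [[m /= nm <-] [/= Au Bv]]] := clxy _ _ Gn nAB; exists m.
Qed.

(** Choose in each [N n] two points at distance more than [d], and let [(x, y)] be a
    cluster point of these pairs. Then [x] and [y] lie in the same component of the
    intersection: a separation of them would, by compactness, already separate some
    [F n], and with it [N m] for some large [m]. *)
Lemma limit_continuum (d : R) (F N : nat -> set X) : 0 < d ->
  (forall n, closed (F n)) -> (forall m n, (m <= n)%N -> F n `<=` F m) ->
  (forall n, [/\ continuum (N n), N n `<=` F n & wider_than d (N n)]) ->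
  exists C, [/\ continuum C, nondegenerate C & forall n, C `<=` F n].
Proof.
move=> d0 cF Fmono NP.
have uvP n : exists p : X * X, [/\ N n p.1, N n p.2 & d < mdist p.1 p.2].
  by have [_ _ [x [y ?]]] := NP n; exists (x, y).
have [w wP] := choice uvP.
have [x [y xyP]] := cluster_pair (fun n => (w n).1) (fun n => (w n).2).
have wF m n : (n <= m)%N -> F n (w m).1 /\ F n (w m).2.
  move=> nm; have [w1 w2 _] := wP m; have [_ NF _] := NP m.
  by split; apply: (Fmono _ _ nm); exact: NF.
have Fx n : F n x.
  apply: (cF n) => A nA; have [m [nm Am _]] := xyP A setT n nA filterT.
  by exists (w m).1; split=> //; have [] := wF m n nm.
have Fy n : F n y.
  apply: (cF n) => B nB; have [m [nm _ Bm]] := xyP setT B n filterT nB.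
  by exists (w m).2; split=> //; have [] := wF m n nm.
have xy : x <> y.
  move=> xy; rewrite -xy in xyP.
  have d20 : 0 < d / 2 by rewrite divr_gt0.
  have [m [_]] := xyP _ _ 0%N (nbhsx_ballx x _ d20) (nbhsx_ballx x _ d20).
  rewrite ballEmdist /= => xw1 xw2; have [_ _] := wP m.
  apply/negP; rewrite -leNgt (le_trans (metric_triangle _ x _))//.
  by rewrite (splitr d) metric_sym ltW// ltrD.
pose Z := \bigcap_(A in range F) A.
have cZ : closed Z by apply: closed_bigI => _ [n _ <-].
have Zx : Z x by move=> _ [n _ <-].
have Zy : Z y by move=> _ [n _ <-].
have Cx := connected_component_refl Zx.
exists (connected_component Z x); split.
- apply: continuumP => //; [by exists x|exact: component_closed|exact: component_connected].
- exists x, y; split => //; apply: contrapT => nCy.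
  have [|P [Q [[cP cQ] ZE dis Px Py]]] := component_clopen_trace hX cX cZ Zx
    (closed_openC (@closed_point _ hX y)).
    by move=> z Cz zy; apply: nCy; rewrite -zy.
  have Qy : Q y by move: (Zy); rewrite ZE => -[/Py/(_ erefl)|].
  have [U [V [oU oV PU QV UV]]] := closed_disjoint_open hX cX cP cQ dis.
  have Ff := decreasing_filtered Fmono.
  have [||_ [n _ <-] FUV] := filtered_bigcap_open cX Ff _ (openU oU oV).
  + by move=> _ [n _ <-].
  + by rewrite -/Z ZE => z [/PU|/QV]; [left|right].
  have [m [nm Um Vm]] := xyP U V n (open_nbhs_nbhs (conj oU (PU _ Px)))
    (open_nbhs_nbhs (conj oV (QV _ Qy))).
  have [w1 w2 _] := wP m; have [[_ _ coN] NF _] := NP m.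
  have /(_ _ w2) Uw2 : N m `<=` U.
    apply: (connected_open_split coN oU oV).
    + by move=> z /NF/(Fmono _ _ nm)/FUV.
    + by move=> z _; exact: UV.
    + by exists (w m).1.
  exact: (UV _ Uw2).
- by move=> n z /connected_component_sub; apply; exists n.
Qed.

Lemma cantor_scheme_not_suslinian (d : R) (cell : set X -> Prop) F0 : 0 < d ->
  (forall F, cell F -> closed F /\
     exists N, [/\ continuum N, N `<=` F & wider_than d N]) ->
  (forall F, cell F -> exists A B, [/\ cell A, cell B, A `<=` F, B `<=` F &
     forall x, A x -> B x -> False]) ->
  cell F0 -> ~ Suslinian X.
Proof.
move=> d0 cellP cell_split cF0 susX.
have split_total F : exists p : set X * set X, cell F ->
    [/\ cell p.1, cell p.2, p.1 `<=` F, p.2 `<=` F & forall x, p.1 x -> p.2 x -> False].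
  have [cF|] := pselect (cell F); last by exists (F, F).
  by have [A [B ?]] := cell_split F cF; exists (A, B).
have [f fP] := choice split_total.
pose T (a : nat -> bool) := fix T n := if n is m.+1 then
  (if a m then (f (T m)).1 else (f (T m)).2) else F0.
have Tcell a n : cell (T a n).
  by elim: n => [//|n /fP[c1 c2 _ _ _]] /=; case: ifP.
have TS a n : T a n.+1 `<=` T a n.
  by have [_ _ s1 s2 _] := fP _ (Tcell a n); rewrite /=; case: ifP.
have Tmono a m n : (m <= n)%N -> T a n `<=` T a m.
  elim: n => [|n IH]; first by rewrite leqn0 => /eqP ->.
  rewrite leq_eqVlt => /predU1P[->//|]; rewrite ltnS => /IH.
  exact: subset_trans (TS a n).
have Tinj a b x : (forall n, T a n x) -> (forall n, T b n x) -> a = b.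
  move=> Ta Tb; have agree n : T a n = T b n /\ forall m, (m < n)%N -> a m = b m.
    elim: n => [//|n [Tn abn]].
    have abn' : a n = b n.
      have [_ _ _ _ dis] := fP _ (Tcell a n).
      have := Ta n.+1; have := Tb n.+1; rewrite /= -Tn.
      by case: (a n); case: (b n) => // h1 h2; exfalso; apply: (dis x).
    split; first by rewrite /= Tn abn'.
    by move=> m; rewrite ltnS leq_eqVlt => /predU1P[->//|/abn].
  by apply/funext => n; have [_] := agree n.+1; apply.
have Cex a : exists C, [/\ continuum C, nondegenerate C & forall n, C `<=` T a n].
  have [N NP] := choice (fun n => (cellP _ (Tcell a n)).2).
  by apply: (limit_continuum d0 _ (Tmono a) NP) => n; have [] := cellP _ (Tcell a n).
have [C CP] := choice Cex.
have Cmeet a b x : C a x -> C b x -> a = b.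
  have [_ _ Ca] := CP a; have [_ _ Cb] := CP b.
  by move=> ax bx; apply: (Tinj a b x) => n; [exact: Ca|exact: Cb].
apply: susX; exists (range C); split.
- move=> /countable_injP[g ginj].
  pose h a := g (C a).
  have hinj a b : h a = h b -> a = b.
    move=> hab; have [[[x Cx] _ _] _ _] := CP a.
    apply: (Cmeet _ _ x) => //.
    by rewrite -(ginj _ _ (mem_set (imageT C a)) (mem_set (imageT C b)) hab).
  (* Cantor's diagonal argument: [a] differs at [n] from every [b] coded by [n]. *)
  pose a n := `[< forall b, h b = n -> b n = false >].
  have [ha|ha] := boolP (a (h a)).
  + by move: (ha) => /asboolP/(_ a erefl); rewrite ha.
  + move/asboolP: (ha); apply => b /hinj ->; exact: negbTE.
- by move=> _ [a _ <-]; have [] := CP a.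
- by move=> _ _ [a _ <-] [b _ <-] [x [Cax Cbx]]; rewrite (Cmeet a b x).
Qed.

End CantorScheme.

Section Hulls.
Context {R : realType} {X : metricType R}.
Hypothesis cX : compact [set: X].
Implicit Types (A B C D K L M P Q O N F V W : set X) (FF : set (set X)).

Let hX : hausdorff_space X := @metric_hausdorff R X.

(** * Hulls and clopen traces *)

Section Traces.
Variable E : set X.

(** The relatively clopen subsets of [E], as subsets of [X], so that their closures
    in [X] can be formed. *)
Definition clopen_trace V :=
  (exists2 O, open O & V = E `&` O) /\ (exists2 F, closed F & V = E `&` F).

Lemma clopen_traceT : clopen_trace E.
Proof.
by split; [exists setT; [exact: openT|]|exists setT; [exact: closedT|]];
  rewrite setIT.
Qed.

Lemma clopen_traceI V W : clopen_trace V -> clopen_trace W ->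
  clopen_trace (V `&` W).
Proof.
move=> [[O oO ->] [F cF EF]] [[O' oO' ->] [F' cF' EF']]; split.
  by exists (O `&` O'); [exact: openI|rewrite setIACA setIid].
by exists (F `&` F'); [exact: closedI|rewrite EF EF' setIACA setIid].
Qed.

Lemma clopen_traceD V W : clopen_trace V -> clopen_trace W ->
  clopen_trace (V `\` W).
Proof.
move=> [[O oO EO] [F cF EF]] [[O' oO' EO'] [F' cF' EF']].
have aux P Q : V = E `&` P -> W = E `&` Q -> V `\` W = E `&` (P `&` ~` Q).
  move=> -> ->; apply/seteqP; split=> x; first by move=> [[Ex Px] n]; split=> //; split=> // Qx; apply: n.
  by move=> [Ex [Px nQ]]; split=> // -[_ /nQ].
split.
- exists (O `&` ~` F'); last exact: aux.
  by apply: openI => //; exact: closed_openC.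
- exists (F `&` ~` O'); last exact: aux.
  by apply: closedI => //; exact: open_closedC.
Qed.

Lemma clopen_trace_sub V : clopen_trace V -> V `<=` E.
Proof. by move=> [[O _ ->] _] x []. Qed.

Lemma clopen_trace_closure V x : clopen_trace V -> E x -> closure V x -> V x.
Proof.
move=> [_ [F cF ->]] Ex clx; split=> //; apply: cF.
by apply: closureS clx => y [].
Qed.

Lemma clopen_trace_nbhs V x : clopen_trace V -> V x ->
  exists O, [/\ open O, O x & E `&` O `<=` V].
Proof. by move=> [[O oO ->] _] [_ Ox]; exists O; split=> // y. Qed.

Lemma open_trace V : V `<=` E ->
  (forall x, V x -> exists O, [/\ open O, O x & E `&` O `<=` V]) ->
  exists2 O, open O & V = E `&` O.
Proof.
move=> VE H; exists (\bigcup_(O in [set O | open O /\ E `&` O `<=` V]) O).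
  by apply: bigcup_open => O [].
apply/seteqP; split=> [x Vx|x [Ex [O [_ OV] Ox]]]; last exact: OV.
by split; [exact: VE|have [O [oO Ox OV]] := H x Vx; exists O].
Qed.

(** Relatively open pieces of a partition of a clopen trace are clopen, each being
    the complement of the other. *)
Lemma clopen_trace_piece V P Q : clopen_trace V -> V = P `|` Q ->
  (forall x, P x -> Q x -> False) ->
  (forall x, P x -> exists O, [/\ open O, O x & E `&` O `<=` P]) ->
  (forall x, Q x -> exists O, [/\ open O, O x & E `&` O `<=` Q]) ->
  clopen_trace P.
Proof.
move=> cV VE dis oP oQ; have VsE := clopen_trace_sub cV.
have [_ [F cF EF]] := cV.
split; first by apply: open_trace => // x Px; apply: VsE; rewrite VE; left.
have [|O oO QO] := open_trace (_ : Q `<=` E) oQ.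
  by move=> x Qx; apply: VsE; rewrite VE; right.
exists (F `&` ~` O); first by apply: closedI => //; exact: open_closedC.
apply/seteqP; split=> x.
- move=> Px; have Vx : V x by rewrite VE; left.
  move: (Vx); rewrite {1}EF => -[Ex Fx]; split=> //; split=> // Ox.
  by apply: (dis x) => //; rewrite QO.
- move=> [Ex [Fx nO]]; have : V x by rewrite EF.
  by rewrite VE => -[//|]; rewrite QO => -[].
Qed.

(** For [e] in [E], the trace of [hull e] on [E] is the quasi-component of [e] in
    [E]. Since closures are taken in a compact space, the hull itself is
    connected, which quasi-components need not be. *)
Definition hull (e : X) :=
  \bigcap_(A in [set closure V | V in [set V | clopen_trace V /\ V e]]) A.

Lemma hull_filtered e : E e ->
  filtered [set closure V | V in [set V | clopen_trace V /\ V e]].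
Proof.
move=> Ee; split.
  by exists (closure E), E => //; split=> //; exact: clopen_traceT.
move=> _ _ [V [cV Ve] <-] [W [cW We] <-]; exists (closure (V `&` W)).
  by exists (V `&` W) => //; split=> //; exact: clopen_traceI.
exact: closureI.
Qed.

Lemma hull_self e : hull e e.
Proof. by move=> _ [V [_ Ve] <-]; exact: subset_closure. Qed.

Lemma hull_sub V e : clopen_trace V -> V e -> hull e `<=` closure V.
Proof. by move=> cV Ve x; apply; exists V. Qed.

Lemma hull_mem V e f : clopen_trace V -> V e -> E f -> hull e f -> V f.
Proof.
by move=> cV Ve Ef ef; apply: (clopen_trace_closure cV Ef); exact: hull_sub ef.
Qed.

Lemma hullN e f : ~ hull e f -> exists V, [/\ clopen_trace V, V e & ~ V f].
Proof.
move=> nef; apply: contrapT => nV; apply: nef => _ [V [cV Ve] <-].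
by apply: subset_closure; apply: contrapT => nVf; apply: nV; exists V.
Qed.

Lemma hull_sep V e f : clopen_trace V -> V e -> ~ V f -> E e -> E f ->
  ~ hull e f /\ ~ hull f e.
Proof.
move=> cV Ve nVf Ee Ef; split; first by move/(hull_mem cV Ve Ef).
have cEV := clopen_traceD clopen_traceT cV.
have EVf : (E `\` V) f by split.
by move/(hull_mem cEV EVf Ee) => -[].
Qed.

Lemma hull_open e O : E e -> open O -> hull e `<=` O ->
  exists V, [/\ clopen_trace V, V e & closure V `<=` O].
Proof.
move=> Ee oO eO.
have [|_ [V [cV Ve] <-] VO] := filtered_bigcap_open cX (hull_filtered Ee) _ oO eO.
  by move=> _ [V _ <-]; exact: closed_closure.
by exists V.
Qed.

Lemma hull_continuum e : E e -> continuum (hull e).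
Proof.
move=> Ee; apply: continuumP => //; first by exists e; exact: hull_self.
  by apply: closed_bigI => _ [V _ <-]; exact: closed_closure.
apply: (@filtered_bigcap_connected _ hX cX _ e (hull_filtered Ee)).
- by move=> _ [V _ <-]; exact: closed_closure.
- by move=> _ [V [_ Ve] <-]; exact: subset_closure.
move=> _ O1 O2 [V [cV Ve] <-] o1 o2 dis V12 O1e.
have VO : V = (V `&` O1) `|` (V `&` O2).
  apply/seteqP; split=> [x Vx|x [[]|[]]] //.
  by have [] := V12 x (@subset_closure _ _ _ Vx); [left|right].
have piece O x : open O -> (V `&` O) x ->
    exists O', [/\ open O', O' x & E `&` O' `<=` V `&` O].
  move=> oO [Vx Ox]; have [O' [oO' O'x O'V]] := clopen_trace_nbhs cV Vx.
  exists (O' `&` O); split=> //; first exact: openI.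
  by move=> y [Ey [O'y Oy]]; split=> //; exact: O'V.
have cV1 : clopen_trace (V `&` O1).
  apply: (clopen_trace_piece cV VO) => //.
  - by move=> x [_ ?] [_ ?]; exact: (dis x).
  - by move=> x; exact: piece.
  - by move=> x; exact: piece.
exists (closure (V `&` O1)); first by exists (V `&` O1).
move=> x clx; have [//|O2x] : (O1 `|` O2) x.
  by apply: V12; apply: closureS clx => y [].
have [y [[_ O1y] O2y]] := clx _ (open_nbhs_nbhs (conj o2 O2x)).
by case: (dis y).
Qed.

End Traces.

(** Irreducibility of [K] between [L] and [M] persists approximately for connected
    sets close to [K]. Indeed no continuum in [K] that avoids a ball around [u]
    joins [L] to [M], so the part of [K] outside the ball is separated between
    them, and disjoint open neighbourhoods of the two parts do the rest. *)
Lemma irreducible_tube K L M u (r : R) : closed K -> closed L -> closed M ->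
  L `<=` K -> M `<=` K ->
  (forall N, continuum N -> N `<=` K -> N `&` L !=set0 -> N `&` M !=set0 -> N = K) ->
  K u -> 0 < r ->
  exists O G H, [/\ [/\ open O, open G & open H], K `<=` O, L `<=` G, M `<=` H &
    forall N, connected N -> N `<=` O -> N `&` G !=set0 -> N `&` H !=set0 ->
      exists2 w, N w & mdist u w < r].
Proof.
move=> cK cL cM LK MK irr Ku r0.
pose b := (ball u r)°.
have ob : open b by exact: open_interior.
have bu : b u by exact: nbhsx_ballx.
have bdist w : b w -> mdist u w < r.
  by move/interior_subset; rewrite ballEmdist.
pose Z := K `&` ~` b.
have cZ : closed Z by apply: closedI => //; exact: open_closedC.
have [|C coC CZ [x [Cx [Lx _]]] [y [Cy My]]|P [Q [[cP cQ] ZE dis LP MP]]] :=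
  @cut_wire _ hX cX Z (L `&` Z) M cZ (closedI cL cZ) cM.
- by move=> z [].
- have clZ : closure C `<=` Z.
    by move/closure_id: cZ => ->; exact: closureS.
  have CK : closure C = K.
    apply: irr.
    + apply: continuumP => //; last exact: connected_closure.
        by exists x; exact: subset_closure.
      exact: closed_closure.
    + by move=> z /clZ[].
    + by exists x; split=> //; exact: subset_closure.
    + by exists y; split=> //; exact: subset_closure.
  by have [] : Z u by apply: clZ; rewrite CK.
have [U [V [oU oV PU QV UV]]] := closed_disjoint_open hX cX cP cQ dis.
have Kcov z : K z -> b z \/ Z z.
  by move=> Kz; have [bz|nbz] := pselect (b z); [left|right].
exists (b `|` (U `|` V)), (b `|` U), (b `|` V); split.
- by split; repeat apply: openU.
- move=> z /Kcov[|]; first by left.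
  by rewrite ZE => -[/PU|/QV]; [right; left|right; right].
- by move=> z Lz; case: (Kcov z (LK _ Lz)) => [|Zz]; [left|right; apply: PU; exact: LP].
- move=> z Mz; case: (Kcov z (MK _ Mz)) => [|]; first by left.
  by rewrite ZE => -[/(MP _ Mz)//|/QV]; right.
move=> N coN NO [x [Nx Gx]] [y [Ny Hy]]; apply: contrapT => nw.
have nb z : N z -> b z -> False by move=> Nz /bdist bz; apply: nw; exists z.
have Ux : U x by case: Gx => // /(nb _ Nx).
have Vy : V y by case: Hy => // /(nb _ Ny).
have /(_ _ Ny) Uy : N `<=` U.
  apply: (connected_open_split coN oU oV); [|by move=> z _; exact: UV|by exists x].
  by move=> z Nz; case: (NO z Nz) => // /(nb _ Nz).
exact: (UV y).
Qed.

End Hulls.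

(** * A hull that is a point *)

Section DegenerateHull.
Context {R : realType} {X : metricType R}.
Hypothesis cX : compact [set: X].
Implicit Types (A B C D K L M P Q O N F V W : set X) (FF : set (set X)).

Let hX : hausdorff_space X := @metric_hausdorff R X.

Variable E : set X.
Hypothesis E_nested : forall x, E x -> nested_at x.
Hypothesis Xdec : forall K, continuum K -> nondegenerate K -> decomposable K.

(** A Lindelof property: a sequence is obtained by choosing, for each basic open set
    whose trace lies in a good clopen trace, one such clopen trace. *)
Lemma refine_to_sequence (good : set X -> Prop) (Y : set X) :
  (forall y, Y y -> exists W, [/\ clopen_trace E W, W y & good W]) ->
  Y `<=` E -> good set0 ->
  exists W : nat -> set X, (forall n, clopen_trace E (W n) /\ good (W n)) /\
    forall y, Y y -> exists n, W n y.
Proof.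
move=> H YE g0; have [B [oB Bbase]] := countable_base cX.
have c0 : clopen_trace E set0.
  by split; [exists set0; [exact: open0|]|exists set0; [exact: closed0|]]; rewrite setI0.
have Wex n : exists W, [/\ clopen_trace E W, good W &
    (exists W', [/\ clopen_trace E W', good W' & E `&` B n `<=` W']) -> E `&` B n `<=` W].
  have [[W' [? ? ?]]|] := pselect (exists W', [/\ clopen_trace E W', good W' & E `&` B n `<=` W']).
    by exists W'.
  by exists set0.
have [W WP] := choice Wex; exists W; split; first by move=> n; have [] := WP n.
move=> y Yy; have [W' [cW' W'y gW']] := H y Yy.
have [O [oO Oy OW']] := clopen_trace_nbhs cW' W'y.
have [n Bny BO] := Bbase O y oO Oy; exists n.
have [_ _] := WP n; apply; last by split=> //; exact: YE.
by exists W'; split => // z [Ez /BO Oz]; exact: OW'.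
Qed.

(** Let [K] be the hull of [e], with ends [L] and [M]. If no hull as claimed exists,
    then, by [irreducible_tube], the hull of each point near [K] but outside it
    misses a neighbourhood of [L] or a neighbourhood of [M]. The points of [E] near
    [K] then split: those in [L], together with pieces outside [K] that stay away
    from [M], form a clopen trace [S], of which the points in [M] and the other
    pieces are the complement. The closure of [S] contains [K], but it misses
    [M]. *)
Lemma wide_hull_nearby (d : R) e V : 0 <= d -> E e -> wider_than d (hull E e) ->
  clopen_trace E V -> V e ->
  exists y, [/\ V y, ~ hull E e y & wider_than d (hull E y)].
Proof.
move=> d0 Ee wide cV Ve; set K := hull E e in wide *.
have Kc : continuum K by exact: hull_continuum.
have cK := continuum_closed Kc.
have Knd := wider_nondegenerate d0 wide.
have Ke : K e by exact: hull_self.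
have e_nested := E_nested Ee.
have Kdec C : continuum C -> nondegenerate C -> C `<=` K -> decomposable C.
  by move=> *; exact: Xdec.
pose L := near_end K e; pose M := far_end K e.
have Lc : continuum L := near_end_continuum cX Kc Knd Ke e_nested Kdec.
have cL := continuum_closed Lc.
have cM : closed M := @far_end_closed _ _ K e.
have LK : L `<=` K := near_end_subK Kc Knd Ke e_nested Kdec.
have MK : M `<=` K := far_end_sub Kc Knd Ke e_nested Kdec.
have LM : forall x, L x -> M x -> False := near_far_disjoint cX Kc Knd Ke e_nested Kdec.
have [m Mm] : M !=set0 := far_end_neq0 cX Kc Knd Ke e_nested Kdec.
have irr N : continuum N -> N `<=` K -> N `&` L !=set0 -> N `&` M !=set0 -> N = K.
  exact: (ends_irreducible cX Kc Knd Ke e_nested Kdec).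
have Kends f : E f -> K f -> L f \/ M f.
  by move=> Ef Kf; apply: (nested_in_ends cX Kc e_nested Kf); exact: E_nested.
have [u [v [Ku Kv duv]]] := wide.
(* Points within [r] of [u] and of [v] are still more than [d] apart. *)
pose r := (mdist u v - d) / 2.
have r0 : 0 < r by rewrite divr_gt0// subr_gt0.
have [O1 [G1 [H1 [[oO1 oG1 oH1] KO1 LG1 MH1 tube1]]]] :=
  irreducible_tube cX cK cL cM LK MK irr Ku r0.
have [O2 [G2 [H2 [[oO2 oG2 oH2] KO2 LG2 MH2 tube2]]]] :=
  irreducible_tube cX cK cL cM LK MK irr Kv r0.
have [||G [oG LG GS]] := @closed_open_shrink _ hX cX L (G1 `&` G2 `&` ~` M) cL.
- by apply: openI; [exact: openI|exact: closed_openC].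
- by move=> x Lx; split; [split; [exact: LG1|exact: LG2]|exact: LM].
have [||H [oH MH HS]] := @closed_open_shrink _ hX cX M (H1 `&` H2 `&` ~` L) cM.
- by apply: openI; [exact: openI|exact: closed_openC].
- by move=> x Mx; split; [split; [exact: MH1|exact: MH2]|move=> Lx; exact: (LM x)].
have [||V1 [cV1 V1e V1O]] := @hull_open _ _ cX E e (O1 `&` O2) Ee.
- exact: openI.
- by move=> x Kx; split; [exact: KO1|exact: KO2].
pose V' := V `&` V1.
have cV' : clopen_trace E V' by exact: clopen_traceI.
have V'E := clopen_trace_sub cV'.
apply: contrapT => nwide.
pose good W := [/\ W `<=` V', forall x, W x -> ~ K x &
  (forall x, W x -> ~ G x) \/ (forall x, W x -> ~ H x)].
have good0 : good set0 by split=> //; left.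
have hull_good y : (V' `\` K) y -> exists W, [/\ clopen_trace E W, W y & good W].
  move=> [V'y nKy]; have Ey := V'E _ V'y.
  have [U [cU Ue nUy]] := hullN nKy.
  have WP O : open O -> hull E y `<=` O -> exists W, [/\ clopen_trace E W, W y,
      W `<=` V', forall x, W x -> ~ K x & W `<=` O].
    move=> oO yO; have [W [cW Wy WO]] := hull_open cX Ey oO yO.
    exists ((W `\` U) `&` V'); split.
    - by apply: clopen_traceI => //; exact: clopen_traceD.
    - by split.
    - by move=> x [].
    - by move=> x [[Wx nUx] V'x] Kx; apply: nUx; apply: (hull_mem cU Ue (V'E _ V'x) Kx).
    - by move=> x [[Wx _] _]; apply: WO; exact: subset_closure.
  have [yG|yG] := pselect (hull E y `<=` ~` closure G).
    have [W [cW Wy WV' WK WG]] := WP _ (closed_openC (@closed_closure _ G)) yG.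
    exists W; split=> //; split=> //; left=> x Wx Gx.
    by apply: (WG x Wx); exact: subset_closure.
  have [yH|yH] := pselect (hull E y `<=` ~` closure H).
    have [W [cW Wy WV' WK WH]] := WP _ (closed_openC (@closed_closure _ H)) yH.
    exists W; split=> //; split=> //; right=> x Wx Hx.
    by apply: (WH x Wx); exact: subset_closure.
  have meets Z : ~ (hull E y `<=` ~` closure Z) -> exists2 x, hull E y x & closure Z x.
    by move=> /existsNP[x /not_implyP[yx /contrapT Zx]]; exists x.
  have [a ya Ga] := meets _ yG; have [b yb Hb] := meets _ yH.
  have [[G1a G2a] _] := GS _ Ga; have [[H1b H2b] _] := HS _ Hb.
  have [_ _ coy] := hull_continuum cX Ey.
  have yO : hull E y `<=` O1 `&` O2.
    by apply: subset_trans V1O; apply: hull_sub => //; case: V'y.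
  have [|||u' yu' uu'] := tube1 _ coy; [by move=> x /yO[]|by exists a|by exists b|].
  have [|||v' yv' vv'] := tube2 _ coy; [by move=> x /yO[]|by exists a|by exists b|].
  exfalso; apply: nwide; exists y; split=> //; first by case: V'y.
  exists u', v'; split=> //.
  have h1 := metric_triangle u u' v; have h2 := metric_triangle u' v' v.
  have h3 := metric_sym v' v.
  have : mdist u v < r + (mdist u' v' + r).
    apply: le_lt_trans h1 _; apply: ltrD => //; apply: le_lt_trans h2 _.
    by rewrite ltrD2l h3.
  rewrite addrCA -splitr addrC -ltrBlDl.
  by rewrite opprB addrCA subrr addr0.
have YE : V' `\` K `<=` E by move=> x [/V'E].
have [W [Wgood Wcov]] := refine_to_sequence hull_good YE good0.
have Wc n : clopen_trace E (W n) by have [] := Wgood n.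
have WV' n : W n `<=` V' by have [_ []] := Wgood n.
have WK n x : W n x -> ~ K x by have [_ []] := Wgood n => _ + _; apply.
pose away n := forall x, W n x -> ~ H x.
have awayN n x : W n x -> H x -> ~ away n by move=> Wx Hx /(_ x Wx).
have awayP n x : W n x -> G x -> away n.
  by move=> Wx Gx; have [_ [_ _ [/(_ x Wx)|]]] := Wgood n.
(* Assigning each point to the first [W n] that contains it turns the cover into a
   partition, which is relatively open as only finitely many [W k] precede. *)
pose first n x := W n x /\ forall k, (k < n)%N -> ~ W k x.
have first_ex x : V' x -> ~ K x -> exists n, first n x.
  move=> V'x nKx; have [k Wkx] := Wcov x (conj V'x nKx).
  have ex : exists n, `[< W n x >] by exists k; apply/asboolP.
  case: (ex_minnP ex) => n /asboolP Wn nmin; exists n; split=> // l ln Wl.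
  by have := nmin l (asboolT Wl); rewrite leqNgt ln.
have first_uniq n k x : first n x -> first k x -> n = k.
  move=> [Wn nmin] [Wk kmin]; case: (ltngtP n k) => //.
  - by move/kmin.
  - by move/nmin.
have first_open n x : E x -> first n x ->
    exists O, [/\ open O, O x & forall z, E z -> O z -> first n z].
  move=> Ex [Wn nmin].
  have [O [oO Ox OP]] : exists O, [/\ open O, O x &
      forall z, E z -> O z -> forall k, (k < n)%N -> ~ W k z].
    elim: n nmin {Wn} => [|n IH] nmin.
      by exists setT; split=> //; exact: openT.
    have [k kn|O [oO Ox OP]] := IH; first by apply: nmin; exact: ltnW.
    have : (E `\` W n) x by split=> //; exact: nmin.
    move=> /(clopen_trace_nbhs (clopen_traceD (clopen_traceT E) (Wc n))).
    move=> [O' [oO' O'x O'W]]; exists (O `&` O'); split=> //; first exact: openI.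
    move=> z Ez [Oz O'z] k; rewrite ltnS leq_eqVlt => /predU1P[->|kn].
      by have [] : (E `\` W n) z by exact: O'W.
    exact: OP.
  have [O' [oO' O'x O'W]] := clopen_trace_nbhs (Wc n) Wn.
  exists (O `&` O'); split=> //; first exact: openI.
  by move=> z Ez [Oz O'z]; split; [exact: O'W|exact: OP].
pose S := [set x | (E x /\ L x) \/ exists2 n, first n x & away n].
pose T := [set x | (E x /\ M x) \/ exists2 n, first n x & ~ away n].
have V'K x : E x -> K x -> V' x by exact: hull_mem.
have V'e : V' e by split.
have V'ST : V' = S `|` T.
  apply/seteqP; split=> x.
  - move=> V'x; have Ex := V'E _ V'x; have [Kx|nKx] := pselect (K x).
      by case: (Kends x Ex Kx) => ?; [left; left|right; left].
    have [n nx] := first_ex x V'x nKx.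
    by have [?|?] := pselect (away n); [left; right|right; right]; exists n.
  - move=> [[[Ex Lx]|[n [Wx _] _]]|[[Ex Mx]|[n [Wx _] _]]].
    + by apply: V'K => //; exact: LK.
    + exact: WV' Wx.
    + by apply: V'K => //; exact: MK.
    + exact: WV' Wx.
have cS : clopen_trace E S.
  apply: (clopen_trace_piece cV' V'ST).
  - move=> x [[Ex Lx]|[n nx an]] [[_ Mx]|[k kx ak]].
    + exact: (LM x).
    + by case: kx => /WK + _; apply; exact: LK.
    + by case: nx => /WK + _; apply; exact: MK.
    + by apply: ak; rewrite -(first_uniq _ _ _ nx kx).
  - move=> x [[Ex Lx]|[n nx an]].
    + have V'x := V'K _ Ex (LK _ Lx).
      have [O [oO Ox OV]] := clopen_trace_nbhs cV' V'x.
      exists (O `&` G); split; [exact: openI|by split=> //; exact: LG|].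
      move=> z [Ez [Oz Gz]]; have V'z : V' z by exact: OV.
      have [Kz|nKz] := pselect (K z).
        left; split=> //; case: (Kends z Ez Kz) => // Mz.
        by have [_ []] := GS z (@subset_closure _ _ _ Gz).
      have [k kz] := first_ex z V'z nKz; right; exists k => //.
      by case: kz => Wz _; exact: awayP Gz.
    + have Ex : E x by apply: V'E; case: nx => /WV'.
      have [O [oO Ox OP]] := first_open n x Ex nx.
      by exists O; split=> // z [Ez Oz]; right; exists n => //; exact: OP.
  - move=> x [[Ex Mx]|[n nx an]].
    + have V'x := V'K _ Ex (MK _ Mx).
      have [O [oO Ox OV]] := clopen_trace_nbhs cV' V'x.
      exists (O `&` H); split; [exact: openI|by split=> //; exact: MH|].
      move=> z [Ez [Oz Hz]]; have V'z : V' z by exact: OV.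
      have [Kz|nKz] := pselect (K z).
        left; split=> //; case: (Kends z Ez Kz) => // Lz.
        by have [_ []] := HS z (@subset_closure _ _ _ Hz).
      have [k kz] := first_ex z V'z nKz; right; exists k => //.
      by case: kz => Wz _; exact: awayN Hz.
    + have Ex : E x by apply: V'E; case: nx => /WV'.
      have [O [oO Ox OP]] := first_open n x Ex nx.
      by exists O; split=> // z [Ez Oz]; right; exists n => //; exact: OP.
have Se : S e by left; split=> //; exact: near_end_e.
have clSm : closure S m by apply: (hull_sub cS Se); exact: MK.
have [z [Sz Hz]] := clSm _ (open_nbhs_nbhs (conj oH (MH _ Mm))).
have [[_ Lz]|[n [Wz _] an]] := Sz; last exact: (an z Wz Hz).
by have [_ []] := HS z (@subset_closure _ _ _ Hz).
Qed.

(** If [hull E a] met both of the others, its unions with them would be continua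
    containing [a], neither of which contains the other. *)
Lemma hull_disjoint_or a b c : E a -> E b -> E c ->
  ~ hull E a b -> ~ hull E a c -> ~ hull E b c -> ~ hull E c b ->
  (forall x, hull E a x -> hull E b x -> False) \/
  (forall x, hull E a x -> hull E c x -> False).
Proof.
move=> Ea Eb Ec ab ac bc cb.
apply: contrapT => /not_orP [nab nac].
have [x ax bx] : exists2 x, hull E a x & hull E b x.
  by apply: contrapT => nx; apply: nab => x ax bx; apply: nx; exists x.
have [y ay cy] : exists2 y, hull E a y & hull E c y.
  by apply: contrapT => ny; apply: nac => y ay cy; apply: ny; exists y.
have [[ha hb] hc] := (hull_continuum cX Ea, hull_continuum cX Eb, hull_continuum cX Ec).
have hab : continuum (hull E a `|` hull E b) by apply: continuumU => //; exists x.
have hac : continuum (hull E a `|` hull E c) by apply: continuumU => //; exists y.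
have aa := @hull_self _ _ E a.
case: (E_nested Ea hab hac (or_introl aa) (or_introl aa)).
- by move=> /(_ b (or_intror (@hull_self _ _ E b)))[].
- by move=> /(_ c (or_intror (@hull_self _ _ E c)))[].
Qed.

(** Closures of clopen traces around points with wide hulls are the cells of a
    Cantor scheme: near such a point there are two further points with wide hulls,
    and of three different hulls two are disjoint. *)
Lemma degenerate_hull_exists : Suslinian X -> E !=set0 ->
  exists2 e, E e & hull E e = [set e].
Proof.
move=> susX [e0 Ee0]; apply: contrapT => nE.
have [x [y [xx yy xy]]] : nondegenerate (hull E e0).
  apply: contrapT => nd; apply: nE; exists e0 => //.
  exact: nondegenerateN (@hull_self _ _ E e0) nd.
have dxy : 0 < mdist x y by rewrite mdist_gt0; exact/eqP.
pose d := mdist x y / 2.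
have d0 : 0 < d by rewrite divr_gt0.
pose cell F := exists V e, [/\ clopen_trace E V, E e, V e, F = closure V &
  wider_than d (hull E e)].
apply: (@cantor_scheme_not_suslinian _ _ cX d cell (closure E) d0 _ _ _ susX).
- move=> _ [V [e [cV Ee Ve -> we]]]; split; first exact: closed_closure.
  by exists (hull E e); split=> //; [exact: hull_continuum|exact: hull_sub].
- move=> _ [V [e [cV Ee Ve -> we]]].
  have disj y' : V y' -> wider_than d (hull E y') ->
      (forall z, hull E e z -> hull E y' z -> False) ->
      exists A B, [/\ cell A, cell B, A `<=` closure V, B `<=` closure V &
        forall z, A z -> B z -> False].
    move=> Vy' wy' dis; have Ey' := clopen_trace_sub cV Vy'.
    have [O1 [O2 [o1 o2 eO yO O12]]] := closed_disjoint_open hX cX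
      (continuum_closed (hull_continuum cX Ee))
      (continuum_closed (hull_continuum cX Ey')) dis.
    have [V1 [cV1 V1e V1O]] := hull_open cX Ee o1 eO.
    have [V2 [cV2 V2y V2O]] := hull_open cX Ey' o2 yO.
    exists (closure (V `&` V1)), (closure (V `&` V2)); split.
    + by exists (V `&` V1), e; split=> //; exact: clopen_traceI.
    + by exists (V `&` V2), y'; split=> //; exact: clopen_traceI.
    + by apply: closureS => z [].
    + by apply: closureS => z [].
    + move=> z /closureI[_ /V1O z1] /closureI[_ /V2O z2]; exact: (O12 z).
  have [y1 [Vy1 ey1 wy1]] := wide_hull_nearby (ltW d0) Ee we cV Ve.
  have Ey1 := clopen_trace_sub cV Vy1.
  have [U [cU Ue nUy1]] := hullN ey1.
  have [y2 [[Vy2 Uy2] ey2 wy2]] := wide_hull_nearby (ltW d0) Ee we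
    (clopen_traceI cV cU) (conj Ve Ue).
  have Ey2 := clopen_trace_sub cV Vy2.
  have [y21 y12] := hull_sep cU Uy2 nUy1 Ey2 Ey1.
  have [dis|dis] := hull_disjoint_or Ee Ey1 Ey2 ey1 ey2 y12 y21.
  + exact: (disj y1).
  + exact: (disj y2).
- exists E, e0; split=> //; first exact: clopen_traceT.
  exists x, y; split=> //; rewrite /d ltr_pdivrMr// ltr_pMr// ltr1n //.
Qed.

Lemma degenerate_hull_zero_dimensional (e : set_type E) :
  hull E (set_val e) = [set set_val e] -> zero_dimensional_at e.
Proof.
move=> he N Ne.
have Ee : E (set_val e) by exact: set_valP.
have [O [oO Oe ON]] : exists O, [/\ open O, O (set_val e) & set_val @^-1` O `<=` N].
  by move: Ne => -[_ [[O oO <-] Oe ON]]; exists O.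
have [|V [[[P oP VP] [Q cQ VQ]] Ve VO]] := hull_open cX Ee oO.
  by rewrite he => _ ->.
exists (set_val @^-1` V); split=> //; last first.
  by move=> x Vx; apply: ON; apply: VO; exact: subset_closure.
have cval : continuous (set_val : set_type E -> X) by exact: initial_continuous.
have preE P' : V = E `&` P' -> set_val @^-1` V = set_val @^-1` P' :> set (set_type E).
  move=> ->; apply/seteqP; split=> x; first by case.
  by move=> ?; split=> //; exact: set_valP.
split.
- by rewrite (preE P VP); have /continuousP := cval; apply.
- by rewrite (preE Q VQ); apply: preimage_closed cQ => x _; exact: cval.
Qed.

End DegenerateHull.

Theorem corollary2 (R : realType) (X : metricType R) :
  continuum [set: X] -> Suslinian X -> chainable X ->
  exists e : set_type (endpoints X), zero_dimensional_at e.
Proof.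
move=> Xc susX chX; have [_ cX _] := Xc.
have Xdec (K : set X) : continuum K -> nondegenerate K -> decomposable K.
  by move=> Kc Knd; exact: suslinian_decomposable.
have E_nested x : endpoints X x -> nested_at x by exact: endpoint_nested.
have E0 := endpoint_exists cX Xc chX Xdec.
have [e Ee he] := degenerate_hull_exists cX E_nested Xdec susX E0.
exists (exist _ e (mem_set Ee)).
exact: degenerate_hull_zero_dimensional.
Qed.
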